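(* Let $k\in\mathbb N$, $k\geq 1$. The restricted Eisenstein series $F_{k,u}$, where $u\in N^{-1}S$, are linearly independent and form a basis of $\mathrm{Eis}_k(N)$. The dimension of the $C_\infty$-vector space $\mathrm{Eis}_k(N)$ equals $\#(S)=c_r(N)$.
   Context: $\mathbb F=\mathbb F_q$ is the finite field with $q$ elements, $A=\mathbb F[T]$, $K=\mathbb F(T)$, $K_\infty=\mathbb F((T^{-1}))$, and $C_\infty$ is the completed algebraic closure of $K_\infty$. $r\ge2$ is an integer and $N\in A$ is monic of degree $d\ge1$. $\Psi^r=\{\omega=(\omega_1,\dots,\omega_r)\in C_\infty^r : \omega_1,\dots,\omega_r\ K_\infty\text{-linearly independent}\}$. For $a\in K^r$ write $a\omega=\sum_i a_i\omega_i$. For $u\in(N^{-1}A/A)^r$ the partial Eisenstein series of weight $k$ is the function on $\Psi^r$ $$E_{k,u}(\omega)=\sum_{0\neq\lambda\in K^r,\ \lambda\equiv u\ (\mathrm{mod}\ A^r)}(\lambda\omega)^{-k},$$ and $\mathrm{Eis}_k(N)=\sum_{u\in(N^{-1}A/A)^r}C_\infty E_{k,u}$. The restricted Eisenstein series is $$F_{k,u}(\omega)=N^{-k}\sum_{a}(a\omega)^{-k},$$ the sum over all primitive $a=(a_1,\dots,a_r)\in A^r$ (i.e. $\sum_iAa_i=A$) with $a\equiv Nu\pmod N$. $(A/N)^r_{\mathrm{prim}}$ is the set of elements of $(A/N)^r$ that belong to some basis of the free $A/N$-module $(A/N)^r$; $\mathcal C_r(N)=(A/N)^r_{\mathrm{prim}}/\mathbb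 F^*$ and $c_r(N)=\#\mathcal C_r(N)$. $S\subset(A/N)^r_{\mathrm{prim}}$ is the set of monic elements: $(n_1,\dots,n_r)$ is monic if its first non-vanishing entry has a monic representative in $A$ of degree $<d$; $S$ is a set of representatives for $\mathcal C_r(N)$. $N^{-1}S=\{n/N : n\in S\}\subset(N^{-1}A/A)^r$. *)

(* Defs.v *)
From HB Require Import structures.
From mathcomp Require Import all_boot all_order all_algebra finmap.
From mathcomp Require Import all_classical all_reals all_analysis.
From mathcomp Require Import summability.

Set Implicit Arguments.
Unset Strict Implicit.
Unset Printing Implicit Defensive.

Import Order.TTheory GRing.Theory Num.Theory.
Import numFieldNormedType.Exports.

Local Open Scope classical_set_scope.
Local Open Scope ring_scope.

Local Notation "x %:F" := (tofrac x).

Section LinearAlgebra.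
Variables (R : nzRingType) (V : lmodType R).

Definition lin_indep (I : finType) (b : I -> V) : Prop :=
  forall c : I -> R, \sum_i c i *: b i = 0 -> forall i, c i = 0.

Definition lin_span (I : finType) (b : I -> V) : set V :=
  [set v | exists c : I -> R, v = \sum_i c i *: b i].

Definition is_basis (I : finType) (b : I -> V) (W : set V) : Prop :=
  lin_indep b /\ lin_span b = W.

Definition has_dim (W : set V) (n : nat) : Prop :=
  exists b : 'I_n -> V, is_basis b W.

End LinearAlgebra.

Arguments has_dim {R V}.

(* An extension of K = F(T) with a non-archimedean absolute value extending
   the absolute value of K at infinity, |a| = q ^ deg a for 0 <> a in F[T].
   It carries no topological structure of the library because those of normed
   type require a base field of characteristic 0. *)
Record valued_extension (F : finFieldType) (R : realType) := ValuedExtension {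
  vfield :> fieldType;
  emb : {rmorphism {fraction {poly F}} -> vfield};
  vabs : vfield -> R;
  vabs_ge0 : forall x, 0 <= vabs x;
  vabs_eq0 : forall x, vabs x = 0 <-> x = 0;
  vabsM : forall x y, vabs (x * y) = vabs x * vabs y;
  vabsD : forall x y, vabs (x + y) <= Num.max (vabs x) (vabs y);
  vabs_emb : forall p : {poly F}, p != 0 ->
    vabs (emb p%:F) = #|F|%:R ^+ (size p).-1
}.

Section CompletedAlgebraicClosure.
Variables (F : finFieldType) (R : realType) (C : valued_extension F R).

Definition vcvg (T : Type) (f : T -> C) (G : set_system T) (l : C) : Prop :=
  vabs (f t - l) @[t --> G] --> (0 : R).

Definition vcomplete : Prop :=
  forall u : nat -> C,
    (forall e : R, 0 < e -> exists n0 : nat, forall m n : nat,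
        (n0 <= m)%N -> (n0 <= n)%N -> vabs (u m - u n) < e) ->
    exists l : C, vcvg u \oo l.

Definition laurent_term (m : int) (c : nat -> F) (i : nat) : C :=
  emb C (c i)%:P%:F * emb C ('X)%:F ^ (m - i%:Z).

(* The subfield F((1/T)) of C: the sums of the Laurent series
   c_0 T^m + c_1 T^(m-1) + c_2 T^(m-2) + ... (all of them converge if C is
   complete). *)
Definition Kinf : set C :=
  [set x | exists (m : int) (c : nat -> F),
     vcvg (series (laurent_term m c)) \oo x].

Definition Kinf_alg : set C :=
  [set x | exists p : {poly C}, [/\ p != 0, forall i, Kinf p`_i & root p x]].

(* C is a completion of an algebraic closure of Kinf, namely of Kinf_alg. *)
Definition is_Cinf : Prop :=
  [/\ vcomplete,
      forall p : {poly C}, (1 < size p)%N -> (forall i, Kinf_alg p`_i) ->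
        exists2 x, Kinf_alg x & root p x
    & forall (x : C) (e : R), 0 < e ->
        exists2 y, Kinf_alg y & vabs (x - y) < e].

End CompletedAlgebraicClosure.

Section InfiniteSums.
Variables (F : finFieldType) (R : realType) (C : valued_extension F R).
Variables (I : choiceType) (P : set I) (f : I -> C).

(* Unordered summation over an infinite index set, as the limit along the net
   of finite subsets. *)
Definition has_vsum (s : C) : Prop :=
  vcvg (fun J : {fset I} => \sum_(i <- J | i \in P) f i) totally s.

(* Junk value 0 if the sum diverges. *)
Definition vsum : C := xget 0 [set s | has_vsum s].

End InfiniteSums.

Section Eisenstein.
Variables (F : finFieldType) (R : realType) (C : valued_extension F R).
Variable (r : nat).

Definition Psi : set 'rV[C]_r :=
  [set w | forall c : 'I_r -> C, (forall i, Kinf (c i)) ->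
     \sum_i c i * w 0 i = 0 -> forall i, c i = 0].

(* The C-vector space of functions on Psi is the lmodType Psi_fun. *)
Definition Psi_fun := {w : 'rV[C]_r | Psi w} -> C^o.

Definition pairing (a : 'rV[{fraction {poly F}}]_r) (w : 'rV[C]_r) : C :=
  \sum_i emb C (a 0 i) * w 0 i.

Definition toK (a : 'rV[{poly F}]_r) : 'rV[{fraction {poly F}}]_r :=
  map_mx (fun x => x%:F) a.

(* In E and Fr, the vector u stands for its class modulo A^r, A = F[T]. *)
Definition E (k : nat) (u : 'rV[{fraction {poly F}}]_r) : Psi_fun :=
  fun w => vsum
    [set l : 'rV[{fraction {poly F}}]_r |
       l != 0 /\ exists b : 'rV[{poly F}]_r, l - u = toK b]
    (fun l => pairing l (sval w) ^- k).

Definition primitive (a : 'rV[{poly F}]_r) : Prop :=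
  forall x : {poly F}, exists b : 'rV[{poly F}]_r, x = \sum_i b 0 i * a 0 i.

Variable (N : {poly F}).

Definition Fr (k : nat) (u : 'rV[{fraction {poly F}}]_r) : Psi_fun :=
  fun w => emb C N%:F ^- k * vsum
    [set a : 'rV[{poly F}]_r |
       primitive a /\ exists b : 'rV[{poly F}]_r,
         toK a - N%:F *: u = N%:F *: toK b]
    (fun a => pairing (toK a) (sval w) ^- k).

(* The isomorphism n |-> n / N from (A/N)^r to (N^-1 A / A)^r, with values in
   representatives. For N monic of positive degree, {poly %/ N} is A/N. *)
Definition divN (n : 'rV[{poly %/ N}]_r) : 'rV[{fraction {poly F}}]_r :=
  \row_i ((n 0 i : {poly F})%:F / N%:F).

Definition Eis (k : nat) : set Psi_fun :=
  lin_span (fun n : 'rV[{poly %/ N}]_r => E k (divN n)).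

End Eisenstein.

Section Cusps.
Variables (F : finFieldType) (r : nat) (N : {poly F}).

Definition in_some_basis (n : 'rV[{poly %/ N}]_r) : Prop :=
  exists (m : nat) (b : 'I_m -> 'rV[{poly %/ N}]_r),
    is_basis b setT /\ exists i, b i = n.

Definition prim : {set 'rV[{poly %/ N}]_r} :=
  [set n | `[< in_some_basis n >]]%SET.

Definition F_orbit (n : 'rV[{poly %/ N}]_r) : {set 'rV[{poly %/ N}]_r} :=
  [set qpolyC N c *: n | c in [pred c : F | c != 0]]%SET.

Definition cusps : {set {set 'rV[{poly %/ N}]_r}} :=
  [set F_orbit n | n in prim]%SET.

Definition monic_elt (n : 'rV[{poly %/ N}]_r) : Prop :=
  exists i : 'I_r,
    [/\ forall j : 'I_r, (j < i)%N -> n 0 j = 0,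
        n 0 i != 0
      & exists p : {poly F},
          [/\ p \is monic, (size p < size N)%N & in_qpoly N p = n 0 i]].

Definition monic_prim : {set 'rV[{poly %/ N}]_r} :=
  [set n in prim | `[< monic_elt n >]]%SET.

End Cusps.

Arguments prim {F} r N.
Arguments cusps {F} r N.
Arguments monic_prim {F} r N.
Arguments Psi_fun {F R} C r.
Arguments E {F R} C {r} k u.
Arguments Fr {F R} C {r} N k u.
Arguments Eis {F R} C r N k.

(* Main.v *)
Require Import Defs.
From HB Require Import structures.
From mathcomp Require Import all_boot all_order all_algebra finmap.
From mathcomp Require Import all_classical all_reals all_analysis.
From mathcomp Require Import summability ring.

Set Implicit Arguments.
Unset Strict Implicit.
Unset Printing Implicit Defensive.

Import Order.TTheory GRing.Theory Num.Theory.

Local Open Scope classical_set_scope.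
Local Open Scope ring_scope.

(** For a residue vector [n] modulo [N], let [G_n(w)] be the sum of [(a w)^-k]
    over the primitive vectors [a] that reduce to [n], so that the restricted
    Eisenstein series of [n] is [F_n = N^-k G_n]. Let [S] be the set of monic
    primitive residue vectors.

    The Eisenstein series are combinations of the [F_n'] with [n'] in [S]: a
    nonzero vector over [F[T]] is [h a'] for exactly one nonzero polynomial
    [h] and one primitive [a'] whose reduction is in [S] ([monic_factor],
    [monic_factor_uniq]). Sorting the terms of [E_n] by the reduction [n'] of
    [a'] gives [E_n = sum_n' N^2k M(n, n') F_n'], where [M(n, n')] is the sum
    of [h^-k] over the nonzero [h] with [h n' = n] ([E_decomp]).

    Conversely, for [n] and [n'] in [S], a constant [h] with [h n' = n] can
    only be [1], and then [n = n']. The other [h] have [|h^-k| < 1], so [M] is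
    the identity up to entries of absolute value less than [1]. Such a matrix
    over an ultrametric field is invertible, because a nonzero vector in its
    kernel would have a largest entry and that entry could not be cancelled
    ([near_identity_inj]). Therefore the [F_n] are combinations of the [E_n].

    Linear independence comes from the same remark about matrices. Lift [n] in
    [S] to a primitive vector [a0]; the lift exists because there are at least
    two coordinates to adjust ([prim_lift]). There is a point [w] with
    [a0 w = 1] and [|a w| > 1] for every primitive [a] that is not a constant
    multiple of [a0] ([cusp_point]); it plays the role of a neighbourhood of the
    cusp of [n]. At [w] the value [G_n'(w)] is [1] up to a term of absolute
    value less than [1] if [n' = n], and has absolute value less than [1]
    otherwise ([Fam_free]).

    All the sums converge because the vectors [w] under consideration span
    discrete lattices ([Psi_discrete]): the completion of [F(T)] at infinity is
    locally compact, so lattice vectors of relatively small value would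
    accumulate to a linear relation between the coordinates of [w]. An
    ultrametric sum converges as soon as its terms tend to zero, and
    rearrangements and products need nothing more. *)

(** * Ultrametric estimates *)

Section Ultrametric.
Variables (F : finFieldType) (R : realType) (C : valued_extension F R).
Implicit Types x y : C.

Local Notation "`‖ x ‖" := (vabs (x : C)) (at level 0, x at level 99, format "`‖ x ‖").

Lemma vabs0 : `‖0‖ = 0 :> R.
Proof. by apply/vabs_eq0. Qed.

Lemma vabs_neq0 x : (`‖x‖ != 0) = (x != 0).
Proof. by congr (~~ _); apply/eqP/eqP => /vabs_eq0. Qed.

Lemma vabs_gt0 x : (0 < `‖x‖) = (x != 0).
Proof. by rewrite lt_neqAle eq_sym vabs_ge0 andbT vabs_neq0. Qed.

Lemma vabs1 : `‖1‖ = 1 :> R.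
Proof.
have n0 : `‖1‖ != 0 :> R by rewrite vabs_neq0 oner_eq0.
by apply: (mulfI n0); rewrite -vabsM !mulr1.
Qed.

Lemma vabsN x : `‖- x‖ = `‖x‖.
Proof.
have h : `‖-1‖ = 1 :> R.
  apply/eqP; rewrite -(@eqrXn2 _ 2) ?vabs_ge0 ?ler01 //.
  by rewrite expr1n expr2 -vabsM mulrNN mulr1 vabs1.
by rewrite -mulN1r vabsM h mul1r.
Qed.

Lemma vabsX x n : `‖x ^+ n‖ = `‖x‖ ^+ n.
Proof. by elim: n => [|n ih]; rewrite ?vabs1 // !exprS vabsM ih. Qed.

Lemma vabsV x : `‖x^-1‖ = `‖x‖^-1.
Proof.
have [->|x0] := eqVneq x 0; first by rewrite invr0 vabs0 invr0.
by apply: (mulfI (_ : `‖x‖ != 0)); rewrite ?vabs_neq0 // -vabsM !divff ?vabs1 ?vabs_neq0.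
Qed.

Lemma vabsXz x (m : int) : `‖x ^ m‖ = `‖x‖ ^ m.
Proof.
by case: m => n; rewrite ?NegzE -?exprnN -?exprnP ?vabsV vabsX.
Qed.

Lemma vabsD_lt x y e : `‖x‖ < e -> `‖y‖ < e -> `‖x + y‖ < e.
Proof. by move=> hx hy; rewrite (le_lt_trans (vabsD _ _)) // gt_max hx. Qed.

Lemma vabsB_lt x y e : `‖x‖ < e -> `‖y‖ < e -> `‖x - y‖ < e.
Proof. by move=> hx hy; rewrite vabsD_lt ?vabsN. Qed.

Lemma vabs_subC x y : `‖x - y‖ = `‖y - x‖.
Proof. by rewrite -vabsN opprB. Qed.

Lemma vabsD_le x y e : `‖x‖ <= e -> `‖y‖ <= e -> `‖x + y‖ <= e.
Proof. by move=> hx hy; rewrite (le_trans (vabsD _ _)) // ge_max hx. Qed.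

Lemma vabs_sum_lt (I : eqType) (s : seq I) (P : pred I) (f : I -> C) e :
  0 < e -> {in s, forall i, P i -> `‖f i‖ < e} -> `‖\sum_(i <- s | P i) f i‖ < e.
Proof.
move=> e0 h; rewrite big_seq_cond; elim/big_ind: _ => [|x y|i /andP[]].
- by rewrite vabs0.
- exact: vabsD_lt.
- exact: h.
Qed.

Lemma vabs_sum_le (I : eqType) (s : seq I) (P : pred I) (f : I -> C) e :
  0 <= e -> {in s, forall i, P i -> `‖f i‖ <= e} -> `‖\sum_(i <- s | P i) f i‖ <= e.
Proof.
move=> e0 h; rewrite big_seq_cond; elim/big_ind: _ => [|x y|i /andP[]].
- by rewrite vabs0.
- exact: vabsD_le.
- exact: h.
Qed.

Lemma vabsD_dom x y : `‖y‖ < `‖x‖ -> `‖x + y‖ = `‖x‖.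
Proof.
move=> h; apply/eqP; rewrite eq_le (le_trans (vabsD _ _)) ?ge_max ?lexx ?(ltW h) //=.
rewrite leNgt; apply/negP => h2.
by have := vabsB_lt h2 h; rewrite addrK ltxx.
Qed.

Lemma vabs_close x y : `‖x - y‖ < `‖x‖ -> `‖y‖ = `‖x‖.
Proof.
by move=> h; rewrite -[y](subKr x) vabsD_dom ?vabsN.
Qed.

(** Only summands of equal, maximal absolute value can make the absolute value
    of a sum drop; here no two summands tie. *)
Lemma vabs_sum_distinct (I : finType) (f : I -> C) :
  (forall i j, f i != 0 -> `‖f i‖ = `‖f j‖ -> i = j) ->
  forall i, `‖f i‖ <= `‖\sum_j f j‖.
Proof.
move=> inj i; have [m _ hm] := arg_maxP (fun i => `‖f i‖) (isT : xpredT i).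
have {}hm j : `‖f j‖ <= `‖f m‖ by apply: hm.
apply: le_trans (hm i) _.
have [fm0|fm0] := eqVneq (f m) 0; first by rewrite fm0 vabs0 vabs_ge0.
rewrite (bigD1 m) //= vabsD_dom //; apply: vabs_sum_lt; first by rewrite vabs_gt0.
move=> j _ jm; rewrite lt_neqAle (hm j) andbT.
by apply: contra jm => /eqP /esym /inj -> .
Qed.

(** A nonzero solution would have a coefficient of maximal absolute value,
    and in the corresponding equation its term could not be cancelled. *)
Lemma near_identity_inj (I : finType) (B : I -> I -> C) :
  (forall i j, `‖B i j - (i == j)%:R‖ < 1) ->
  forall c : I -> C, (forall j, \sum_i c i * B i j = 0) -> forall i, c i = 0.
Proof.
move=> hB c hc i; have [m _ hm] := arg_maxP (fun i => `‖c i‖) (isT : xpredT i).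
have {}hm j : `‖c j‖ <= `‖c m‖ by apply: hm.
suff cm0 : c m = 0.
  apply/vabs_eq0/eqP; rewrite eq_le vabs_ge0 andbT.
  by rewrite (le_trans (hm i)) // cm0 vabs0.
apply/eqP; case: (boolP (c m == 0)) => // cm0; have cmgt : 0 < `‖c m‖ by rewrite vabs_gt0.
have h : `‖\sum_i c i * (B i m - (i == m)%:R)‖ < `‖c m‖.
  apply: vabs_sum_lt => // j _ _; rewrite vabsM.
  by rewrite (le_lt_trans (ler_wpM2r (vabs_ge0 _) (hm j))) // gtr_pMr.
move: h; under eq_bigr do rewrite mulrBr.
rewrite big_split /= hc add0r sumrN vabsN (bigD1 m) //= eqxx mulr1 big1 ?addr0 ?ltxx //.
by move=> j /negPf ->; rewrite mulr0.
Qed.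

End Ultrametric.

(** * Unordered sums *)

Section Sums.
Variables (F : finFieldType) (R : realType) (C : valued_extension F R).
Local Notation "`‖ x ‖" := (vabs (x : C)) (at level 0, x at level 99, format "`‖ x ‖").

Lemma vcvgP (T : Type) (f : T -> C) (G : set_system T) (l : C) : Filter G ->
  vcvg f G l <-> forall e : R, 0 < e -> \forall t \near G, `‖f t - l‖ < e.
Proof.
move=> FG; have hE t : `|0 - `‖f t - l‖ | = `‖f t - l‖.
  by rewrite sub0r normrN ger0_norm ?vabs_ge0.
split=> [/cvgrPdist_lt h e /h|h].
  by apply: filterS => t /=; rewrite hE.
apply/cvgrPdist_lt => e /h; apply: filterS => t /=.
by rewrite hE.
Qed.

Section OneFamily.
Variables (I : choiceType) (P : set I) (f : I -> C).

Definition tail_lt (e : R) (J : seq I) : Prop :=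
  forall i, P i -> i \notin J -> `‖f i‖ < e.

Definition approx_sum (s : C) (e : R) (J : seq I) : Prop :=
  [/\ uniq J, {in J, forall i, P i}, tail_lt e J & `‖\sum_(i <- J) f i - s‖ < e].

(** The terms common to both lists cancel, and a remaining term is omitted by
    one of the two lists, hence small. *)
Lemma tail_lt_sum e J J' : 0 < e -> uniq J -> uniq J' ->
  {in J, forall i, P i} -> {in J', forall i, P i} ->
  tail_lt e J -> tail_lt e J' ->
  `‖\sum_(i <- J) f i - \sum_(i <- J') f i‖ < e.
Proof.
move=> e0 uJ uJ' JP JP' tJ tJ'.
rewrite (bigID (mem J')) /= [X in _ - X](bigID (mem J)) /=.
rewrite -[X in _ - (X + _)]big_filter -[X in X + _ - _]big_filter.
have /(perm_big _) -> : perm_eq [seq i <- J' | i \in J] [seq i <- J | i \in J'].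
  apply: uniq_perm; rewrite ?filter_uniq // => i.
  by rewrite !mem_filter andbC.
rewrite opprD addrACA subrr add0r; apply: vabsB_lt; apply: vabs_sum_lt => // i.
  by move=> /JP Pi; apply: tJ'.
by move=> /JP' Pi; apply: tJ.
Qed.

(** One finite list per [e] is enough, instead of all the finite sets beyond
    some finite set: by the ultrametric inequality, adding any number of terms
    smaller than [e] changes a partial sum by less than [e]. Conversely the
    terms of a convergent family are differences of partial sums. *)
Lemma has_vsumP s :
  has_vsum P f s <-> forall e, 0 < e -> exists J, approx_sum s e J.
Proof.
have mkJ (J : seq I) : {J' : seq I | uniq J' /\ forall i, (i \in J') = (i \in J) && `[< P i >]}.
  exists [seq i <- undup J | `[< P i >]]; split; first by rewrite filter_uniq ?undup_uniq.
  by move=> i; rewrite mem_filter mem_undup andbC.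
split=> [hs e e0|hs].
  have [J0 _ hJ0] := (vcvgP _ _ totally_filter).1 hs e e0.
  have hJ (J : {fset I}) : {subset J0 <= J} -> `‖\sum_(i <- J | i \in P) f i - s‖ < e.
    move=> sJ; apply: hJ0 => /=; apply/fsubsetP => x xJ; exact: sJ.
  have [J [uJ mJ]] := mkJ J0.
  have JE : \sum_(i <- J) f i = \sum_(i <- J0 | i \in P) f i.
    rewrite -[RHS]big_filter; apply/perm_big/uniq_perm; rewrite ?filter_uniq // => i.
    by rewrite mem_filter mJ andbC /=; congr (_ && _).
  exists J; split=> //.
  - by move=> i; rewrite mJ => /andP[_ /asboolP].
  - move=> i Pi; rewrite mJ asboolT // andbT => iJ0.
    have /hJ : {subset J0 <= (i |` J0)%fset} by move=> j jJ; rewrite !inE jJ orbT.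
    rewrite big_mkcond big_fsetU1 //= mem_set // -big_mkcond => h.
    rewrite (_ : f i = f i + \sum_(i <- J0 | i \in P) f i - s - (\sum_(i <- J0 | i \in P) f i - s)).
      by apply: vabsB_lt h (hJ _ _).
    by rewrite opprB addrA subrK addrK.
  - by rewrite JE; apply: hJ.
apply/(vcvgP _ _ totally_filter) => e e0; have [J [uJ JP tJ sJ]] := hs e e0.
exists [fset i in J]%fset => // J' /fsubsetP sJJ'.
rewrite -big_filter.
rewrite -[X in X - s](subrK (\sum_(i <- J) f i)) -addrA.
apply: vabsD_lt sJ; apply: tail_lt_sum => //; rewrite ?filter_uniq //.
  by move=> i; rewrite mem_filter => /andP[/set_mem].
move=> i Pi; rewrite mem_filter mem_set //= => iJ'; apply: tJ => //.
by apply: contra iJ' => iJ; apply: sJJ'; rewrite inE.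
Qed.

Lemma has_vsum_uniq s t : has_vsum P f s -> has_vsum P f t -> s = t.
Proof.
move=> /has_vsumP hs /has_vsumP ht; apply/eqP; rewrite -subr_eq0.
rewrite -[_ == 0]negbK -(@vabs_gt0 _ _ C); apply/negP => st.
have [J [uJ JP tJ sJ]] := hs _ st; have [J' [uJ' JP' tJ' sJ']] := ht _ st.
suff : `‖s - t‖ < `‖s - t‖ by rewrite ltxx.
rewrite {1}(_ : s - t = (\sum_(i <- J) f i - \sum_(i <- J') f i)
   - (\sum_(i <- J) f i - s) + (\sum_(i <- J') f i - t)); last first.
  by ring.
by apply: vabsD_lt => //; apply: vabsB_lt => //; apply: tail_lt_sum.
Qed.

Lemma vsumE s : has_vsum P f s -> vsum P f = s.
Proof.
move=> hs; rewrite /vsum; case: xgetP => [t _ ht|/(_ s)//].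
exact: has_vsum_uniq hs.
Qed.

Lemma has_vsum_bounded s : has_vsum P f s ->
  exists2 B, 0 < B & forall i, P i -> `‖f i‖ < B.
Proof.
move=> /has_vsumP/(_ 1 ltr01) [J [uJ JP tJ _]].
exists (1 + \sum_(i <- J) `‖f i‖) => [|i Pi].
  by rewrite ltr_pwDl ?sumr_ge0 // => i _; apply: vabs_ge0.
have [iJ|/(tJ _ Pi) h] := boolP (i \in J).
  rewrite ltr_pwDl // (big_rem i) //= lerDl sumr_ge0 // => j _; apply: vabs_ge0.
by rewrite ltr_wpDr ?sumr_ge0 // => j _; apply: vabs_ge0.
Qed.

(** The strict bound survives the passage to the limit, because the sum is
    already within [e] of a finite partial sum. *)
Lemma has_vsum_lt s e : 0 < e -> has_vsum P f s ->
  (forall i, P i -> `‖f i‖ < e) -> `‖s‖ < e.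
Proof.
move=> e0 /has_vsumP/(_ e e0) [J [uJ JP tJ sJ]] h.
rewrite -[s](subKr (\sum_(i <- J) f i)); apply: vabsB_lt => //.
by apply: vabs_sum_lt => // i /JP; auto.
Qed.

Lemma has_vsum_dom s e i0 : 0 < e -> has_vsum P f s -> P i0 -> e <= `‖f i0‖ ->
  (forall i, P i -> i != i0 -> `‖f i‖ < e) -> `‖s - f i0‖ < e.
Proof.
move=> e0 /has_vsumP/(_ e e0) [J [uJ JP tJ sJ]] Pi0 h0 h.
have i0J : i0 \in J by apply: contraLR h0 => /(tJ _ Pi0); rewrite ltNge.
move: sJ; rewrite (big_rem i0) //= => sJ.
rewrite (_ : s - f i0 = (\sum_(y <- rem i0 J) f y)
   - (f i0 + \sum_(y <- rem i0 J) f y - s)); last first.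
  by ring.
apply: vabsB_lt => //; apply: vabs_sum_lt => // i.
by rewrite mem_rem_uniq // inE => /andP[ii0 /JP Pi] _; apply: h.
Qed.

(** Partial sums over lists that capture all the terms of size at least [1/n]
    form a Cauchy sequence, and any two choices of such lists give the same
    limit. *)
Lemma has_vsum_exists : vcomplete C ->
  (forall e, 0 < e -> exists J, tail_lt e J) -> exists s, has_vsum P f s.
Proof.
move=> hC hJ.
have : forall n : nat, exists J, [/\ uniq J, {in J, forall i, P i} & tail_lt n.+1%:R^-1 J].
  move=> n; have [|J tJ] := hJ n.+1%:R^-1; first by rewrite invr_gt0 ltr0n.
  exists [seq i <- undup J | `[< P i >]]; split.
  - by rewrite filter_uniq ?undup_uniq.
  - by move=> i; rewrite mem_filter => /andP[/asboolP].
  - move=> i Pi; rewrite mem_filter mem_undup asboolT //=; exact: tJ.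
move=> /choice [J hJn].
have tailW m n : (m <= n)%N -> tail_lt m.+1%:R^-1 (J n).
  move=> mn i Pi iJ; have [_ _ /(_ i Pi iJ)] := hJn n.
  by move=> /lt_le_trans; apply; rewrite lef_pV2 ?posrE ?ltr0n // ler_nat.
have close m n n' : (m <= n)%N -> (m <= n')%N ->
    `‖\sum_(i <- J n) f i - \sum_(i <- J n') f i‖ < m.+1%:R^-1.
  move=> mn mn'; have [? ? _] := hJn n; have [? ? _] := hJn n'.
  by apply: tail_lt_sum; rewrite ?invr_gt0 ?ltr0n //; apply: tailW.
have arch (e : R) : 0 < e -> exists n : nat, n.+1%:R^-1 < e.
  by move=> e0; have [n _] := near_infty_natSinv_lt (PosNum e0); move/(_ n (leqnn n)); exists n.
have [s hs] : exists s : C, vcvg (fun n => \sum_(i <- J n) f i) \oo s.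
  apply: hC => e /arch [n hn]; exists n => m m' h h'.
  exact: lt_trans (close n m m' h h') hn.
exists s; apply/has_vsumP => e e0; have [n0 hn0] := arch e e0.
have [n1 _ hn1] := (vcvgP _ _ _).1 hs e e0.
exists (J (maxn n0 n1)); have [uJ JP _] := hJn (maxn n0 n1); split => //.
  move=> i Pi iJ; apply: lt_trans hn0; apply: (@tailW _ (maxn n0 n1)) => //.
  exact: leq_maxl.
exact: hn1 (maxn n0 n1) (leq_maxr _ _).
Qed.

End OneFamily.

Lemma has_vsum_reindex (I I' : choiceType) (P : set I) (Q : set I')
    (phi : I -> I') (f : I -> C) (g : I' -> C) s :
  has_vsum P f s -> (forall i j, P i -> P j -> phi i = phi j -> i = j) ->
  (forall j, Q j <-> exists2 i, P i & phi i = j) ->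
  (forall i, P i -> g (phi i) = f i) ->
  has_vsum Q g s.
Proof.
move=> /has_vsumP hs inj QP gf; apply/has_vsumP => e e0.
have [J [uJ JP tJ sJ]] := hs e e0; exists [seq phi i | i <- J]; split.
- by rewrite map_inj_in_uniq // => i j /JP Pi /JP Pj; apply: inj.
- by move=> _ /mapP[i /JP Pi ->]; apply/QP; exists i.
- move=> j /QP[i Pi <-] jJ; rewrite gf //; apply: tJ => //.
  by apply: contra jJ => iJ; apply: map_f.
- rewrite big_map (eq_big_seq f) // => i /JP; exact: gf.
Qed.

Lemma has_vsumM (I I' : choiceType) (P : set I) (Q : set I')
    (f : I -> C) (g : I' -> C) s t :
  has_vsum P f s -> has_vsum Q g t ->
  has_vsum [set ij : I * I' | P ij.1 /\ Q ij.2] (fun ij => f ij.1 * g ij.2) (s * t).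
Proof.
move=> hs ht.
have [B0 B0_gt0 hB0] := has_vsum_bounded hs; have [B1 B1_gt0 hB1] := has_vsum_bounded ht.
pose B := Num.max B0 B1; have Bgt0 : 0 < B by rewrite lt_max B0_gt0.
have {}hB0 i : P i -> `‖f i‖ < B by move=> /hB0 h; rewrite lt_max h.
have {}hB1 i : Q i -> `‖g i‖ < B by move=> /hB1 h; rewrite lt_max h orbT.
have sB : `‖s‖ < B by apply: has_vsum_lt hs hB0.
apply/has_vsumP => e e0; have eB : 0 < e / B by rewrite divr_gt0.
have lt_e x y : `‖x‖ < e / B -> `‖y‖ < B -> `‖x * y‖ < e.
  by move=> hx hy; rewrite vabsM -[e](divfK (lt0r_neq0 Bgt0)) ltr_pM ?vabs_ge0.
move/has_vsumP: hs => /(_ _ eB) [J [uJ JP tJ sJ]].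
move/has_vsumP: ht => /(_ _ eB) [J' [uJ' JP' tJ' sJ']].
exists [seq (i, j) | i <- J, j <- J']; split.
- by apply: allpairs_uniq => // -[? ?] [? ?].
- by move=> _ /allpairsP[[i j] /= [/JP Pi /JP' Pj ->]].
- move=> [i j] /= [Pi Qj] ij; have [iJ|iJ] := boolP (i \in J).
    rewrite mulrC; apply: lt_e (hB0 _ Pi); apply: tJ' => //.
    by apply: contra ij => jJ'; apply/allpairsP; exists (i, j).
  by apply: lt_e (hB1 _ Qj); apply: tJ.
rewrite big_allpairs /=; under eq_bigr do rewrite -mulr_sumr.
rewrite -mulr_suml -[X in X * _](subrK s) mulrDl -addrA -mulrBr.
apply: vabsD_lt; last by rewrite mulrC; apply: lt_e.
by apply: lt_e => //; apply: vabs_sum_lt => // i /JP' /hB1.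
Qed.

Lemma has_vsum_sig (T : finType) (I : choiceType) (P : T -> set I)
    (f : T -> I -> C) (s : T -> C) :
  (forall t, has_vsum (P t) (f t) (s t)) ->
  has_vsum [set ti : T * I | P ti.1 ti.2] (fun ti => f ti.1 ti.2) (\sum_t s t).
Proof.
move=> hs; apply/has_vsumP => e e0.
have /choice [J hJ] : forall t, exists J, approx_sum (P t) (f t) (s t) e J.
  by move=> t; move/has_vsumP: (hs t); apply.
exists [seq (t, i) | t <- enum T, i <- J t]; split.
- apply: allpairs_uniq_dep; rewrite ?enum_uniq //.
    by move=> t _; case: (hJ t).
  by move=> [? ?] [? ?] _ _ [] -> ->.
- move=> _ /allpairsPdep[t [i [_ iJ ->]]] /=.
  by have [_ /(_ i iJ)] := hJ t.
- move=> [t i] /= Pti ti; have [_ _ tJ _] := hJ t; apply: tJ => //.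
  apply: contra ti => iJ; apply/allpairsPdep; exists t, i.
  by rewrite mem_enum.
rewrite big_allpairs_dep big_enum /= -sumrB; apply: vabs_sum_lt => // t _ _.
by case: (hJ t).
Qed.

End Sums.

(** * Primitive vectors over F[T] *)

Section PrimitiveVectors.
Variables (F : finFieldType) (r : nat).
Local Notation A := {poly F}.
Implicit Types (a b : 'rV[A]_r) (g h : A).

Lemma elementary_mulV (i j : 'I_r) (q : A) : i != j ->
  (1%:M - q *: delta_mx i j) *m (1%:M + q *: delta_mx i j) = 1%:M :> 'M[A]_r.
Proof.
move=> ij; rewrite mulmxDr mulmx1 mulmxBl mul1mx -scalemxAl -scalemxAr.
by rewrite mul_delta_mx_0 1?eq_sym // !scaler0 subr0 subrK.
Qed.

(** Euclid's algorithm: while two entries are nonzero, reduce the larger one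
    modulo the smaller one by an elementary column operation. The single entry
    left is the gcd [g], and the product of the operations gives [U]. *)
Lemma unimodular_factor a : (0 < r)%N ->
  exists g (j : 'I_r) (U V : 'M[A]_r), U *m V = 1%:M /\ a = g *: row j U.
Proof.
move=> r_gt0; have [m] := ubnP (\sum_i size (a 0%R i)).
elim: m a => // m ih a; rewrite ltnS => am.
have [[i j]|] := pickP [pred ij : 'I_r * 'I_r | [&& ij.1 != ij.2, a 0 ij.1 != 0
    & (0 < size (a 0%R ij.1) <= size (a 0%R ij.2))%N]].
  rewrite /= => /and3P[ij ai0 /andP[_ sij]].
  pose q := a 0 j %/ a 0 i.
  pose a' := a *m (1%:M - q *: delta_mx i j).
  have a'E l : a' 0 l = if l == j then a 0 j %% a 0 i else a 0 l.
    rewrite /a' mulmxBr mulmx1 -scalemxAr !mxE (bigD1 i) //= !mxE eqxx /= big1; last first.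
      by move=> k /negPf ki; rewrite !mxE ki mulr0.
    case: eqVneq => [->|_]; last by rewrite mulr0 addr0 mulr0 subr0.
    by rewrite mulr1 addr0 [in LHS](divp_eq (a 0 j) (a 0 i)) /q addrC addKr.
  have [|g [l [U [V [UV a'g]]]]] := ih a'.
    apply: leq_trans am; rewrite (bigD1 j) //= [X in (_ < X)%N](bigD1 j) //= a'E eqxx.
    rewrite -addSn leq_add //.
      by apply: leq_trans sij; rewrite ltn_modp.
    by apply: leq_sum => k /negPf kj; rewrite a'E kj.
  exists g, l, (U *m (1%:M + q *: delta_mx i j)), ((1%:M - q *: delta_mx i j) *m V).
  have h := elementary_mulV q ij; split.
    by rewrite mulmxA -(mulmxA U) (mulmx1C h) mulmx1.
  by rewrite row_mul scalemxAl -a'g /a' -mulmxA h mulmx1.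
move=> none.
have [j hj] : exists j, forall i, i != j -> a 0 i = 0.
  have [j aj0|a0] := pickP (fun i => a 0 i != 0).
    exists j => i ij; apply/eqP; case: (boolP (a 0 i == 0)) => // ai0.
    have := none (i, j); have := none (j, i).
    rewrite /= ij aj0 ai0 eq_sym ij !size_poly_gt0 ai0 aj0 /=.
    by case: ltngtP.
  by exists (Ordinal r_gt0) => i _; apply/eqP; have /negbFE := a0 i.
exists (a 0 j), j, 1%:M, 1%:M; split; first by rewrite mulmx1.
apply/rowP => i; rewrite !mxE; case: eqVneq => [->|ij]; first by rewrite mulr1.
by rewrite hj 1?eq_sym // mulr0.
Qed.

Lemma primitiveP a : primitive a <-> exists b, \sum_i b 0 i * a 0 i = 1.
Proof.
split=> [/(_ 1) [b ->]|[b hb] x]; first by exists b.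
exists (x *: b); under eq_bigr do rewrite mxE -mulrA.
by rewrite -mulr_sumr hb mulr1.
Qed.

Lemma primitive_gt0 a : primitive a -> (0 < r)%N.
Proof.
move=> /primitiveP [b]; case: (posnP r) => // r0.
by rewrite big1 => [/esym/eqP|i]; [rewrite oner_eq0 | have := ltn_ord i; rewrite {2}r0].
Qed.

Lemma primitive_row (U V : 'M[A]_r) j : U *m V = 1%:M -> primitive (row j U).
Proof.
move=> UV; apply/primitiveP; exists (\row_i V i j).
have /matrixP/(_ j j) := UV; rewrite !mxE eqxx mulr1n => <-.
by apply: eq_bigr => i _; rewrite !mxE mulrC.
Qed.

(** The gcd of the entries is then a unit, so it can be absorbed in [U]. *)
Lemma primitive_completes a : primitive a ->
  exists (j : 'I_r) (U V : 'M[A]_r), U *m V = 1%:M /\ a = row j U.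
Proof.
move=> pa; have [g [j [U [V [UV aE]]]]] := unimodular_factor a (primitive_gt0 pa).
have [b hb] := (primitiveP a).1 pa.
have [g' gg'] : exists g', g * g' = 1.
  exists (\sum_i b 0 i * U j i); rewrite mulr_sumr -hb aE.
  by apply: eq_bigr => i _; rewrite !mxE mulrCA.
exists j, (g *: U), (g' *: V); split.
  by rewrite -scalemxAl -scalemxAr scalerA gg' UV scale1r.
by rewrite aE; apply/rowP => i; rewrite !mxE.
Qed.

Lemma poly_mul_eq1 g h : g * h = 1 -> exists2 c : F, c != 0 & g = c%:P.
Proof.
move=> gh1; have /size_poly1P[c c0 ->] : size g == 1%N.
  by rewrite -dvdp1 -gh1 dvdp_mulr.
by exists c.
Qed.

(** Both [g] and [h] are gcds of the entries of the same vector, hence differ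
    by a unit of [F[T]]. *)
Lemma primitive_scale_uniq g h a b : g != 0 -> h != 0 ->
  primitive a -> primitive b -> g *: a = h *: b ->
  exists c : F, [/\ c != 0, h = c *: g & a = c%:P *: b].
Proof.
move=> g0 h0 /primitiveP[x xa] /primitiveP[y yb] e.
have ei i : g * a 0 i = h * b 0 i by have /rowP/(_ i) := e; rewrite !mxE.
have gE : g = h * (\sum_i x 0 i * b 0 i).
  rewrite mulr_sumr -[LHS]mulr1 -xa mulr_sumr.
  by apply: eq_bigr => i _; rewrite mulrCA ei mulrCA.
have hE : h = g * (\sum_i y 0 i * a 0 i).
  rewrite mulr_sumr -[LHS]mulr1 -yb mulr_sumr.
  by apply: eq_bigr => i _; rewrite mulrCA -ei mulrCA.
have [|c c0 cE] := @poly_mul_eq1 (\sum_i y 0 i * a 0 i) (\sum_i x 0 i * b 0 i).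
  by apply: (mulfI g0); rewrite mulrA -hE -gE mulr1.
rewrite cE in hE; exists c; split=> //; first by rewrite -mul_polyC mulrC.
apply/rowP => i; rewrite !mxE; apply: (mulfI g0).
by rewrite ei hE mulrA.
Qed.

End PrimitiveVectors.

(** * Reduction modulo N *)

Section Reduction.
Variables (F : finFieldType) (r : nat) (N : {poly F}).
Hypotheses (hN : N \is monic) (hd : (1 < size N)%N).
Local Notation A := {poly F}.
Local Notation Q := {poly %/ N}.
Local Notation red := (map_mx (in_qpoly N) : 'rV[A]_r -> 'rV[Q]_r).
Implicit Types (a b : 'rV[A]_r) (n : 'rV[Q]_r).

Lemma mk_monicE : mk_monic N = N.
Proof. by rewrite /mk_monic hd hN. Qed.

Lemma size_qpoly (x : Q) : (size (x : A) < size N)%N.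
Proof. by rewrite -[in X in (_ < X)%N]mk_monicE size_mk_monic. Qed.

Lemma in_qpolyK (x : Q) : in_qpoly N (x : A) = x.
Proof. by apply: val_inj; apply: in_qpoly_small; rewrite size_mk_monic. Qed.

Lemma in_qpoly_val (p : A) : (size p < size N)%N -> in_qpoly N p = p :> A.
Proof. by move=> sp; rewrite in_qpoly_small // mk_monicE. Qed.

Lemma in_qpolyC c : in_qpoly N c%:P = qpolyC N c.
Proof.
apply: val_inj; apply: in_qpoly_val.
by rewrite size_polyC (leq_ltn_trans _ hd) //; case: eqP.
Qed.

Lemma in_qpoly_eq p q : in_qpoly N p = in_qpoly N q <-> exists y, p = q + N * y.
Proof.
split=> [e|[y ->]].
  have /(congr1 val)/= := e; rewrite mk_monicE => h.
  exists (p %/ N - q %/ N); rewrite [LHS](divp_eq p N) [X in _ = X + _](divp_eq q N).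
  rewrite -!(Pdiv.IdomainMonic.modpE hN) in h; rewrite h; ring.
have N0 : in_qpoly N N = 0.
  by apply: val_inj; rewrite /= mk_monicE Pdiv.RingMonic.rmodpp.
by rewrite in_qpolyD in_qpolyM N0 mul0r addr0.
Qed.

Lemma red_eq a b : red a = red b <-> exists y, a = b + N *: y.
Proof.
split=> [/rowP e|[y ->]]; last first.
  by apply/rowP => i; rewrite !mxE; apply/in_qpoly_eq; exists (y 0 i).
have /choice [y hy] : forall i, exists y, a 0 i = b 0 i + N * y.
  by move=> i; apply/in_qpoly_eq; have := e i; rewrite !mxE.
by exists (\row_i y i); apply/rowP => i; rewrite !mxE.
Qed.

Definition lift_rV n : 'rV[A]_r := \row_i (n 0 i : A).

Lemma red_lift n : red (lift_rV n) = n.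
Proof. by apply/rowP => i; rewrite !mxE in_qpolyK. Qed.

Lemma redZ h a : red (h *: a) = in_qpoly N h *: red a.
Proof. by rewrite map_mxZ. Qed.

(** Completing the vector to an invertible matrix over [F[T]] and reducing the
    matrix and its inverse modulo [N] yields a basis. *)
Lemma red_prim a : primitive a -> red a \in prim r N.
Proof.
move=> /primitive_completes [j [U [V [UV ->]]]]; rewrite inE; apply/asboolP.
pose U' := map_mx (in_qpoly N) U; pose V' := map_mx (in_qpoly N) V.
have UV' : U' *m V' = 1%:M by rewrite -map_mxM UV map_mx1.
have VU' := mulmx1C UV'.
have sumE (c : 'I_r -> Q) : \sum_i c i *: row i U' = \row_i c i *m U'.
  by rewrite mulmx_sum_row; apply: eq_bigr => i _; rewrite mxE.
exists r, (fun i => row i U'); split; last by exists j; rewrite map_row.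
split=> [c hc i|].
  have := congr1 (mulmx^~ V') (sumE c); rewrite hc mul0mx -mulmxA UV' mulmx1.
  by move=> /rowP/(_ i); rewrite !mxE.
apply/seteqP; split=> // v _; exists (fun i => (v *m V') 0 i); rewrite sumE.
rewrite (_ : \row_i _ = v *m V') -?mulmxA ?VU' ?mulmx1 //.
by apply/rowP => i; rewrite mxE.
Qed.

(** The coordinate form of a basis takes the value [1] on the basis vector that
    it belongs to; [x] lists the coefficients of that form. *)
Lemma prim_unimodular n : n \in prim r N -> exists x : 'rV[Q]_r, \sum_i x 0 i * n 0 i = 1.
Proof.
rewrite inE => /asboolP [m [b [[bfree bspan] [i bi]]]].
have /choice [c hc] : forall l : 'I_r, exists c : 'I_m -> Q,
    delta_mx 0 l = \sum_j c j *: b j.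
  by move=> l; have : lin_span b (delta_mx 0 l) by rewrite bspan.
exists (\row_l c l i).
have : \sum_j (\sum_l n 0 l * c l j - (j == i)%:R) *: b j = 0.
  under eq_bigr do rewrite scalerBl scaler_suml.
  rewrite sumrB exchange_big /= (bigD1 i) //= [X in _ - (_ + X)]big1 => [|j /negPf ->].
    rewrite eqxx scale1r addr0 bi; apply/eqP; rewrite subr_eq0; apply/eqP.
    rewrite [RHS]row_sum_delta; apply: eq_bigr => l _.
    by rewrite hc scaler_sumr; apply: eq_bigr => j _; rewrite scalerA.
  by rewrite scale0r.
move=> /bfree/(_ i)/eqP; rewrite eqxx mulr1n subr_eq0 => /eqP <-.
by apply: eq_bigr => l _; rewrite mxE mulrC.
Qed.

Lemma prim_scale c n : c != 0 -> n \in prim r N -> qpolyC N c *: n \in prim r N.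
Proof.
move=> c0; rewrite inE => /asboolP [m [b [[bfree bspan] [i bi]]]]; rewrite inE; apply/asboolP.
have cc : qpolyC N c * qpolyC N c^-1 = 1 by rewrite -qpolyCM divff.
have cc' : qpolyC N c^-1 * qpolyC N c = 1 by rewrite -qpolyCM mulVf.
exists m, (fun j => qpolyC N c *: b j); split; last by exists i; rewrite bi.
split=> [x hx j|].
  have := bfree (fun j => x j * qpolyC N c).
  rewrite (eq_bigr (fun j => x j *: (qpolyC N c *: b j))) => [/(_ hx j) h|? _].
    by rewrite -[x j]mulr1 -cc mulrA h mul0r.
  by rewrite scalerA.
apply/seteqP; split=> // v _; have [y ->] : lin_span b v by rewrite bspan.
exists (fun j => y j * qpolyC N c^-1); apply: eq_bigr => j _.
by rewrite scalerA -mulrA cc' mulr1.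
Qed.

End Reduction.

(** * Monic representatives of the cusps *)

Section Monic.
Variables (F : finFieldType) (r : nat) (N : {poly F}).
Hypotheses (hN : N \is monic) (hd : (1 < size N)%N).
Local Notation A := {poly F}.
Local Notation Q := {poly %/ N}.
Local Notation red := (map_mx (in_qpoly N) : 'rV[A]_r -> 'rV[Q]_r).
Implicit Types (a b : 'rV[A]_r) (n : 'rV[Q]_r).

(** A prime factor of [g] that divides [q] does not divide [N], nor
    [gdcop q g], the largest divisor of [g] prime to [q]; a prime factor of [g]
    that does not divide [q] divides [gdcop q g]. So it divides exactly one of
    the two summands. The proof runs the same argument with common divisors
    instead of primes. *)
Lemma coprimep_shift (g q : A) : g != 0 ->
  (forall e : A, e %| g -> e %| q -> e %| N -> e %| 1) ->
  coprimep g (q + gdcop q g * N).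
Proof.
move=> g0 hgqN; case: gdcopP => t tg; rewrite (negPf g0) orbF => tq tmax.
apply/coprimepP => d dg dqt; rewrite -size_poly_eq1 -dvdp1.
have dq : coprimep d q.
  apply/coprimepP => e ed eq; rewrite -size_poly_eq1 -dvdp1; apply: hgqN => //.
    exact: dvdp_trans ed dg.
  have etN : e %| t * N by rewrite -(dvdp_addr _ eq) (dvdp_trans ed dqt).
  by rewrite -(Gauss_dvdpr _ (_ : coprimep e t)) // coprimep_sym (coprimep_dvdl eq).
have dt : d %| t by apply: tmax.
have dvq : d %| q by rewrite -(dvdp_addl _ (dvdp_mulr N dt)).
by rewrite dvdp1; move/coprimepP: dq => /(_ d (dvdpp d) dvq); rewrite -size_poly_eq1.
Qed.

(** Any lift of [n] together with [N] generates the unit ideal. Make one entry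
    other than [i1] nonzero, so that the gcd [g] of the entries other than [i1]
    is nonzero, and then move the entry [i1] inside its class modulo [N] until
    it becomes prime to [g]. *)
Lemma prim_lift n : (2 <= r)%N -> n \in prim r N ->
  exists2 a, primitive a & red a = n.
Proof.
move=> hr /prim_unimodular [x xn].
pose i0 := Ordinal (ltnW hr); pose i1 := Ordinal hr.
(* The zero class modulo [N] is also represented by the nonzero polynomial
   [N]. *)
pose a2 := \row_i (if (i == i0) && (n 0 i == 0) then N else n 0 i : A).
have red2 : red a2 = n.
  apply/rowP => i; rewrite !mxE; case: ifP => [/andP[_ /eqP ->]|_].
    have -> : in_qpoly N N = in_qpoly N 0.
      by apply/in_qpoly_eq => //; exists 1; rewrite add0r mulr1.
    exact: in_qpoly0.
  exact: in_qpolyK.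
have a20 : a2 0 i0 != 0.
  rewrite mxE eqxx /=; case: ifPn => // _; exact: monic_neq0.
pose a3 := \row_i (if i == i1 then 0 else a2 0 i).
have [g [j [U [V [UV a3g]]]]] := unimodular_factor a3 (ltnW hr).
have /primitiveP[z zb] := primitive_row j UV; set b := row j U in a3g zb.
have g0 : g != 0.
  apply: contraNneq a20 => g0; have /rowP/(_ i0) := a3g.
  by rewrite g0 scale0r [LHS]mxE [RHS]mxE /= => ->.
set q := a2 0 i1.
have gE c : \sum_(i | i != i1) c 0 i * a2 0 i = g * \sum_i c 0 i * b 0 i.
  rewrite mulr_sumr [RHS](bigD1 i1) //=.
  have gb i : g * b 0 i = a3 0 i by rewrite a3g [RHS]mxE.
  rewrite mulrCA gb [a3 _ _]mxE eqxx mulr0 add0r; apply: eq_bigr => i /negPf ii1.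
  by rewrite mulrCA gb [a3 _ _]mxE ii1.
have cop : coprimep g (q + gdcop q g * N).
  apply: coprimep_shift => // e eg eq eN.
  have /(in_qpoly_eq hN hd)[w] : in_qpoly N (\sum_i (x 0 i : A) * a2 0 i) = in_qpoly N 1.
    rewrite rmorph_sum rmorph1 -xn; apply: eq_bigr => i _.
    by rewrite rmorphM /= in_qpolyK //; congr (_ * _); rewrite -red2 [RHS]mxE.
  rewrite (bigD1 i1) //= -/q => h.
  have -> : 1 = (x 0 i1 : A) * q + \sum_(i | i != i1) (lift_rV x) 0 i * a2 0 i - N * w.
    apply/eqP; rewrite eq_sym subr_eq -h; apply/eqP; congr (_ + _).
    by apply: eq_bigr => i _; rewrite mxE.
  rewrite gE; apply: dvdp_sub; last exact: dvdp_mulr.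
  by apply: dvdp_add; [apply: dvdp_mull | apply: dvdp_mulr].
have /Bezout_eq1_coprimepP[[X Y] /= XY] := cop.
set t := gdcop q g in cop XY.
exists (\row_i (if i == i1 then q + t * N else a2 0 i)).
  apply/primitiveP; exists (\row_i (if i == i1 then Y else X * z 0 i)).
  rewrite (bigD1 i1) //= !mxE eqxx -XY addrC; congr (_ + _).
  have -> : g = \sum_(i | i != i1) z 0 i * a2 0 i by rewrite gE zb mulr1.
  by rewrite mulr_sumr; apply: eq_bigr => i /negPf ii1; rewrite !mxE ii1 mulrA.
rewrite -red2; apply/(red_eq hN hd); exists (\row_i (if i == i1 then t else 0)).
apply/rowP => i; rewrite !mxE; case: eqVneq => [->|_]; last by rewrite mulr0 addr0.
by rewrite mulrC /q mxE.
Qed.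

Lemma prim_neq0 n : n \in prim r N -> n != 0.
Proof.
move=> /prim_unimodular [x xn]; apply/eqP => n0; move: xn; rewrite n0 big1.
  by move/esym/eqP; rewrite oner_eq0.
by move=> i _; rewrite mxE mulr0.
Qed.

Lemma qpolyC_eq0 c (x : Q) : c != 0 -> (qpolyC N c * x == 0) = (x == 0).
Proof.
move=> c0; apply/eqP/eqP => [h|->]; last by rewrite mulr0.
have cc : qpolyC N c^-1 * qpolyC N c = 1 by rewrite -qpolyCM mulVf.
by rewrite -[x]mul1r -cc -mulrA h mulr0.
Qed.

(** Divide by the leading coefficient of the first nonzero entry. *)
Lemma monic_normalize n : n != 0 ->
  exists2 c, c != 0 & monic_elt (qpolyC N c *: n).
Proof.
move=> n0; have [i0 ni0] : exists i, n 0 i != 0.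
  by case/matrix0Pn: n0 => i [j]; rewrite ord1; exists j.
have [i ni hi] := @arg_minnP _ i0 (fun i => n 0 i != 0) (fun i : 'I_r => i : nat) ni0.
have p0 : lead_coef (n 0 i : A) != 0 by rewrite lead_coef_eq0.
exists (lead_coef (n 0 i : A))^-1; first by rewrite invr_eq0.
exists i; split.
- move=> j ji; rewrite mxE; apply/eqP; rewrite qpolyC_eq0 ?invr_eq0 //.
  by apply: contraLR ji => /hi; rewrite -leqNgt.
- by rewrite mxE qpolyC_eq0 ?invr_eq0.
exists ((lead_coef (n 0 i : A))^-1 *: (n 0 i : A)); split.
- by rewrite monicE lead_coefZ mulVf.
- by rewrite size_scale ?invr_eq0 // size_qpoly.
- by rewrite mxE -mul_polyC rmorphM /= in_qpolyC // in_qpolyK.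
Qed.

(** The first nonzero entry and its canonical representative are both
    multiplied by [c], and leading coefficients are compared. *)
Lemma monic_elt_scale n c : c != 0 -> monic_elt n -> monic_elt (qpolyC N c *: n) -> c = 1.
Proof.
move=> c0 [i [ni0 ni [p [pm sp pn]]]] [i' [ni0' ni' [p' [pm' sp' pn']]]].
have ii' : i = i'.
  apply: val_inj; case: (ltngtP i i') => // h.
    by have /eqP := ni0' _ h; rewrite mxE qpolyC_eq0 // (negPf ni).
  by move: ni'; rewrite mxE ni0 // mulr0 eqxx.
subst i'; have /(congr1 (@polyn _ _)) : in_qpoly N p' = in_qpoly N (c *: p).
  by rewrite pn' mxE -mul_polyC rmorphM /= in_qpolyC // pn.
rewrite !in_qpoly_val ?size_scale // => p'E.
by have := pm'; rewrite p'E monicE lead_coefZ (monicP pm) mulr1 => /eqP.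
Qed.

Lemma monic_primP n : n \in monic_prim r N <-> n \in prim r N /\ monic_elt n.
Proof.
rewrite [_ \in monic_prim _ _]inE; split=> [/andP[-> /asboolP]//|[-> h]].
by apply/asboolP.
Qed.

(** * Factorization of vectors over F[T] *)

(** Take for [h] the gcd of the entries, times the constant that makes the
    reduction of the cofactor monic. *)
Lemma monic_factor a : a != 0 ->
  exists h a', [/\ h != 0, primitive a', red a' \in monic_prim r N & a = h *: a'].
Proof.
move=> a0; have r_gt0 : (0 < r)%N.
  by case/matrix0Pn: a0 => _ [[m mr] _]; apply: leq_ltn_trans mr.
have [g [j [U [V [UV aE]]]]] := unimodular_factor a r_gt0.
have prU := primitive_row j UV; set b := row j U in prU aE.
have bprim := red_prim N prU.
have [c c0 hc] := monic_normalize (prim_neq0 bprim).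
exists ((c^-1)%:P * g), (c%:P *: b); split.
- rewrite mulf_neq0 ?polyC_eq0 ?invr_eq0 //.
  by apply: contraNneq a0 => g0; rewrite aE g0 scale0r.
- have /primitiveP[x xb] := prU; apply/primitiveP; exists ((c^-1)%:P *: x).
  rewrite -xb; apply: eq_bigr => i _; rewrite !mxE mulrACA -polyCM mulVf //.
  by rewrite mul1r.
- by apply/monic_primP; rewrite redZ in_qpolyC //; split => //; apply: prim_scale.
- by rewrite scalerA mulrAC -polyCM mulVf // mul1r.
Qed.

Lemma monic_factor_uniq h h' a a' : h != 0 -> h' != 0 ->
  primitive a -> primitive a' -> red a \in monic_prim r N ->
  red a' \in monic_prim r N -> h *: a = h' *: a' -> h = h' /\ a = a'.
Proof.
move=> h0 h'0 pa pa' /monic_primP[_ ma] /monic_primP[_ ma'].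
move=> /(primitive_scale_uniq h0 h'0 pa pa') [c [c0 hE aE]].
have c1 : c = 1 by apply: (monic_elt_scale c0 ma'); rewrite -in_qpolyC // -redZ -aE.
by rewrite hE aE c1 !scale1r.
Qed.

(** This is where monic representatives matter: a constant that relates two of
    them is [1]. *)
Lemma monic_prim_scaled n n' (h : A) : h != 0 ->
  n \in monic_prim r N -> n' \in monic_prim r N -> in_qpoly N h *: n' = n ->
  (size h <= 1)%N -> h = 1 /\ n = n'.
Proof.
move=> h0 /monic_primP[_ mn] /monic_primP[_ mn'] hE /size1_polyC hC.
have c0 : h`_0 != 0 by rewrite -polyC_eq0 -hC.
move: hE; rewrite hC in_qpolyC // => hE.
have c1 : h`_0 = 1 by apply: (monic_elt_scale c0 mn'); rewrite hE.
by rewrite -hE c1 scale1r.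
Qed.

Lemma F_orbit_scale n c : c != 0 -> F_orbit (qpolyC N c *: n) = F_orbit n.
Proof.
move=> c0; apply/setP => m; apply/imsetP/imsetP => -[e]; rewrite inE => e0 ->.
  by exists (e * c); rewrite ?inE ?mulf_neq0 // scalerA -qpolyCM.
exists (e / c); first by rewrite inE mulf_neq0 ?invr_eq0.
by rewrite scalerA -qpolyCM divfK.
Qed.

Lemma card_monic_prim : #|monic_prim r N| = #|cusps r N|.
Proof.
have -> : cusps r N = [set F_orbit n | n in monic_prim r N]%SET.
  apply/setP => X; apply/imsetP/imsetP => -[n nP ->]; last first.
    by exists n => //; case/monic_primP: nP.
  have [c c0 hc] := monic_normalize (prim_neq0 nP).
  exists (qpolyC N c *: n); last by rewrite F_orbit_scale.
  by apply/monic_primP; split => //; apply: prim_scale.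
rewrite card_in_imset // => n m /monic_primP[_ mn] /monic_primP[_ mm] e.
have : n \in F_orbit m.
  rewrite -e; apply/imsetP; exists 1; first by rewrite inE oner_eq0.
  by rewrite -[LHS]scale1r.
case/imsetP => c; rewrite inE => c0 nE.
have c1 : c = 1 by apply: (monic_elt_scale c0 mm); rewrite -nE.
by rewrite nE c1 -[RHS]scale1r.
Qed.

End Monic.

(** * Laurent series and a compactness principle *)

(** Extend prefixes one letter at a time, keeping only the prefixes shared by
    infinitely many of the sequences; finitely many letters are available, so
    one of them always works. *)
Lemma konig (V : finType) (x : nat -> nat -> V) :
  exists y : nat -> V, forall L, exists2 m, (L <= m)%N & forall j, (j < L)%N -> x m j = y j.
Proof.
pose v0 := x 0 0.
pose good (s : seq V) := forall M, exists2 m, (M <= m)%N &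
  forall j, (j < size s)%N -> x m j = nth v0 s j.
have step s : exists v, good s -> good (rcons s v).
  have [gs|] := pselect (good s); last by exists v0.
  apply: contrapT => /forallNP none.
  have /choice [M hM] : forall v, exists M, forall m, (M <= m)%N ->
      ~ forall j, (j < size (rcons s v))%N -> x m j = nth v0 (rcons s v) j.
    move=> v; apply: contrapT => /forallNP h; apply: (none v) => _ M.
    have /existsNP [m /not_implyP [Mm /contrapT]] := h M.
    by exists m.
  have [m mM hm] := gs (\max_v M v).
  apply: (hM (x m (size s)) m); first exact: leq_trans (leq_bigmax _) mM.
  move=> j; rewrite size_rcons ltnS leq_eqVlt nth_rcons => /orP[/eqP ->|js].
    by rewrite ltnn eqxx.
  by rewrite js hm.
have /choice [f hf] := step.
pose S n := iter n (fun s => rcons s (f s)) [::].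
have sS n : size (S n) = n by elim: n => // n ih; rewrite /= size_rcons ih.
have gS n : good (S n) by elim: n => [M|n ih]; [exists M | apply: hf].
exists (fun j => nth v0 (S j.+1) j) => L; have [m Lm hm] := gS L L.
exists m => // j jL; rewrite hm ?sS //.
elim: L jL {Lm hm} => // L ih; rewrite ltnS leq_eqVlt => /orP[/eqP <-//|jL].
by rewrite [S _]/= nth_rcons sS jL ih.
Qed.

Section LaurentSeries.
Variables (F : finFieldType) (R : realType) (C : valued_extension F R).
Local Notation "`‖ x ‖" := (vabs (x : C)) (at level 0, x at level 99, format "`‖ x ‖").
Local Notation A := {poly F}.
Local Notation embA p := (emb C (tofrac p)).
Local Notation q := (#|F|%:R : R).

Implicit Types p h : A.

Lemma q_gt1 : 1 < q.
Proof. by rewrite ltr1n card_finNzRing_gt1. Qed.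

Lemma q_gt0 : 0 < q. Proof. exact: lt_trans q_gt1. Qed.

Lemma q_neq0 : q != 0. Proof. exact: lt0r_neq0 q_gt0. Qed.

Lemma q_small (e : R) : 0 < e -> exists n : nat, q ^- n < e.
Proof.
move=> e0; have := archi_boundP (ltW (_ : 0 < e^-1)); rewrite invr_gt0 => /(_ e0).
set n := Num.bound _ => hn; exists n; rewrite -[e]invrK ltf_pV2 ?posrE ?exprn_gt0 ?invr_gt0 ?q_gt0 //.
apply: lt_trans hn _; rewrite -natrX ltr_nat ltn_expl //; exact: card_finNzRing_gt1.
Qed.

Lemma embA_neq0 p : (embA p != 0) = (p != 0).
Proof. by rewrite fmorph_eq0 tofrac_eq0. Qed.

Lemma vabs_embX : `‖embA 'X‖ = q.
Proof. by rewrite vabs_emb ?polyX_eq0 // size_polyX expr1. Qed.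

Lemma vabs_embC (c : F) : `‖embA c%:P‖ = (c != 0)%:R.
Proof.
have [->|c0] := eqVneq c 0; first by rewrite polyC0 tofrac0 rmorph0 vabs0.
by rewrite vabs_emb ?polyC_eq0 // size_polyC c0.
Qed.

Lemma vabs_emb_ge1 p : p != 0 -> 1 <= `‖embA p‖.
Proof. by move=> p0; rewrite vabs_emb // exprn_ege1 // ltW // q_gt1. Qed.

Lemma vabs_emb_size p n : (size p <= n.+1)%N -> `‖embA p‖ <= q ^+ n.
Proof.
move=> sp; have [->|p0] := eqVneq p 0.
  by rewrite tofrac0 rmorph0 vabs0 exprn_ge0 // ltW // q_gt0.
by rewrite vabs_emb // ler_eXn2l ?q_gt1 // -ltnS prednK // size_poly_gt0.
Qed.

Lemma vabs_emb_gt p n : (n < size p)%N -> q ^+ n <= `‖embA p‖.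
Proof.
move=> np; rewrite vabs_emb -?size_poly_gt0 ?(leq_ltn_trans _ np) //.
by rewrite ler_eXn2l ?q_gt1 // -ltnS prednK // (leq_ltn_trans _ np).
Qed.

Lemma laurent_term_le m c i : `‖laurent_term C m c i‖ <= q ^ (m - i%:Z).
Proof.
rewrite vabsM vabsXz vabs_embX vabs_embC ler_piMl ?lern1 ?leq_b1 //.
exact: exprz_ge0 (ltW q_gt0).
Qed.

Lemma laurent_tail m c L n : (L <= n)%N ->
  `‖series (laurent_term C m c) n - series (laurent_term C m c) L‖ <= q ^ (m - L%:Z).
Proof.
move=> Ln; rewrite sub_series_geq //.
apply: vabs_sum_le => [|i]; first by rewrite exprz_ge0 ?ltW ?q_gt0.
rewrite mem_index_iota => /andP[Li _] _; apply: le_trans (laurent_term_le _ _ _) _.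
by apply: (ler_weXz2l (ltW q_gt1)); rewrite lerD2l lerN2 lez_nat.
Qed.

Lemma laurent_close m c c' L n n' : (forall j, (j < L)%N -> c j = c' j) ->
  (L <= n)%N -> (L <= n')%N ->
  `‖series (laurent_term C m c) n - series (laurent_term C m c') n'‖ <= q ^ (m - L%:Z).
Proof.
move=> cc' Ln Ln'.
have e : series (laurent_term C m c) L = series (laurent_term C m c') L.
  by apply: eq_big_nat => j /andP[_ jL]; rewrite /laurent_term cc'.
rewrite (_ : _ - _ = (series (laurent_term C m c) n - series (laurent_term C m c) L) -
  (series (laurent_term C m c') n' - series (laurent_term C m c') L)); last first.
  by rewrite e opprB addrA addrNK.
by apply: vabsD_le; rewrite ?vabsN; apply: laurent_tail.
Qed.

Lemma vcvg_le (u : nat -> C) l x e n : vcvg u \oo l ->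
  (forall k, (n <= k)%N -> `‖u k - x‖ <= e) -> `‖l - x‖ <= e.
Proof.
move=> /vcvgP ul h; apply/ler_addgt0Pr => d d0.
have [n' _ hn'] := ul d d0.
have := hn' (maxn n n') (leq_maxr _ _); have := h (maxn n n') (leq_maxl _ _).
set v := u _ => h1 h2.
rewrite (_ : l - x = (v - x) - (v - l)); last by ring.
have e0 : 0 <= e := le_trans (vabs_ge0 _) h1.
apply: vabsD_le; first by rewrite (le_trans h1) // lerDl ltW.
by rewrite vabsN (le_trans (ltW h2)) // lerDr.
Qed.

Lemma laurent_cvg m c : vcomplete C -> exists x, vcvg (series (laurent_term C m c)) \oo x.
Proof.
move=> hC; apply: hC => e e0.
have e1 : 0 < e / q ^ m by rewrite divr_gt0 // exprz_gt0 // q_gt0.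
have [L hL] := q_small e1.
exists L => n n' Ln Ln'; apply: le_lt_trans (laurent_close _ (fun _ _ => erefl) Ln Ln') _.
rewrite expfzDr ?q_neq0 // -exprnN.
by rewrite -ltr_pdivlMl ?exprz_gt0 ?q_gt0 // mulrC.
Qed.

(** Read from the top, the coefficients of a polynomial of degree at most [D]
    are those of the Laurent series of [p / T^D]. *)
Lemma laurent_poly (p : A) D c n : (size p <= D.+1)%N -> (D < n)%N ->
  (forall j, c j = if (j <= D)%N then p`_(D - j) else 0) ->
  series (laurent_term C 0 c) n = embA p / embA 'X ^+ D.
Proof.
move=> sp Dn hc.
have X0 : embA 'X != 0 by rewrite embA_neq0 polyX_eq0.
have tail0 : \sum_(D.+1 <= i < n) laurent_term C 0 c i = 0.
  rewrite big_nat big1 // => i /andP[Di _]; rewrite /laurent_term hc leqNgt Di /=.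
  by rewrite polyC0 tofrac0 rmorph0 mul0r.
rewrite /series /= (big_cat_nat (n := D.+1)) //= tail0 addr0.
apply: (mulIf (expf_neq0 D X0)); rewrite divfK ?expf_neq0 // mulr_suml.
have -> : p = \poly_(i < D.+1) p`_i.
  apply/polyP => i; rewrite coef_poly; case: ltnP => // Di.
  by rewrite nth_default // (leq_trans sp).
rewrite poly_def rmorph_sum rmorph_sum /=.
rewrite -(big_mkord xpredT (fun i => emb C (tofrac (p`_i *: 'X^i)))) [in RHS]big_nat_rev /=.
apply: eq_big_nat => j /andP[_]; rewrite ltnS => jD; rewrite /laurent_term hc jD.
rewrite add0n subSS -mul_polyC !rmorphM !rmorphXn /= -mulrA; congr (_ * _).
by rewrite [RHS]exprnP [X in _ * X]exprnP -expfzDr // sub0r addrC (subzn jD).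
Qed.

End LaurentSeries.

(** * Convergence of lattice sums *)

Section LatticeSums.
Variables (F : finFieldType) (R : realType) (C : valued_extension F R).
Local Notation "`‖ x ‖" := (vabs (x : C)) (at level 0, x at level 99, format "`‖ x ‖").
Local Notation A := {poly F}.
Local Notation embA p := (emb C (tofrac p)).
Local Notation q := (#|F|%:R : R).

Lemma pairing_toK r (a : 'rV[A]_r) (w : 'rV[C]_r) :
  pairing (toK a) w = \sum_i embA (a 0 i) * w 0 i.
Proof. by apply: eq_bigr => i _; rewrite mxE. Qed.

(** Suppose that for every [m] some [a] has [|a w| < q^-m q^D], where [D] is
    the largest degree of an entry of [a]. The vectors [a / T^D] are integral at
    infinity and not divisible by [1/T]; their expansions in [1/T] have
    coefficients in a finite set, so they accumulate at some nonzero [Y] with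
    entries in the completion of [F(T)] and with [Y w = 0]. This contradicts the
    independence of the coordinates of [w]. *)
Lemma Psi_discrete r (w : 'rV[C]_r) : vcomplete C -> Psi w ->
  exists2 c : R, 0 < c & forall (a : 'rV[A]_r) i, c * `‖embA (a 0 i)‖ <= `‖pairing (toK a) w‖.
Proof.
move=> hC Pw; apply: contrapT => none.
have qV m : 0 < q ^- m by rewrite invr_gt0 exprn_gt0 // q_gt0.
have /choice [aD haD] : forall m : nat, exists aD : 'rV[A]_r * nat,
    [/\ forall i, (size (aD.1 0%R i) <= aD.2.+1)%N, exists i, (aD.1 0 i)`_aD.2 != 0
      & `‖pairing (toK aD.1) w‖ < q ^- m * q ^+ aD.2].
  move=> m; apply: contrapT => /forallNP h; apply: none; exists (q ^- m) => // a i.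
  rewrite leNgt; apply/negP => hlt.
  have [j _ hj] := @arg_maxnP _ i xpredT (fun i => size (a 0 i)) isT.
  have sj : (0 < size (a 0%R j))%N.
    apply: leq_trans (hj i isT); rewrite size_poly_gt0; apply: contraTneq hlt => ->.
    by rewrite tofrac0 rmorph0 vabs0 mulr0 -leNgt vabs_ge0.
  apply: (h (a, (size (a 0%R j)).-1)); split => /=.
  - by move=> l; rewrite prednK //; apply: hj.
  - by exists j; rewrite -lead_coefE lead_coef_eq0 -size_poly_gt0.
  - apply: lt_le_trans hlt _; rewrite ler_pM2l // vabs_emb_size // prednK //.
    exact: hj.
(* The coefficients of [a / T^D] as a series in [1/T]. *)
pose x m j := \row_(i < r) (if (j <= (aD m).2)%N then ((aD m).1 0 i)`_((aD m).2 - j) else 0 : F).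
have [y hy] := konig x.
have /choice [Y hY] : forall i, exists Yi : C,
    vcvg (series (laurent_term C 0 (fun j => y j 0 i))) \oo Yi.
  by move=> i; apply: laurent_cvg.
have [B B1 hB] : exists2 B : R, 1 <= B & forall i, `‖w 0 i‖ <= B.
  exists (1 + \sum_i `‖w 0 i‖) => [|i]; first by rewrite lerDl sumr_ge0 // => i _; apply: vabs_ge0.
  rewrite (bigD1 i) //= addrCA lerDl addr_ge0 ?ler01 // sumr_ge0 // => j _; apply: vabs_ge0.
have B0 : 0 < B by apply: lt_le_trans B1.
pose X m i := embA ((aD m).1 0 i) / embA 'X ^+ (aD m).2.
have YX L m : (L <= m)%N -> (forall j, (j < L)%N -> x m j = y j) ->
    forall i, `‖Y i - X m i‖ <= q ^- L.
  move=> Lm hm i; apply: (vcvg_le (n := L) (hY i)) => n Ln.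
  rewrite /X; have [sD _ _] := haD m.
  rewrite -(@laurent_poly _ _ C _ _ (fun j => x m j 0 i) (maxn L (aD m).2.+1) (sD i)).
  - rewrite (_ : q ^- L = q ^ (0 - L%:Z)); last by rewrite sub0r -exprnN.
    apply: laurent_close => //; last exact: leq_maxl.
    by move=> j /hm ->.
  - exact: leq_maxr.
  - by move=> j; rewrite mxE.
have XW m : `‖\sum_i X m i * w 0 i‖ <= q ^- m.
  have [_ _ /ltW h] := haD m; rewrite /X.
  under eq_bigr do rewrite mulrAC.
  rewrite -mulr_suml -pairing_toK vabsM vabsV vabsX vabs_embX.
  by rewrite ler_pdivrMr // exprn_gt0 // q_gt0.
have YW0 : \sum_i Y i * w 0 i = 0.
  apply/eqP; rewrite -[_ == 0]negbK -(@vabs_gt0 _ _ C); apply/negP => YW.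
  have [L hL] := q_small F (divr_gt0 YW B0); move: hL; apply/negP; rewrite -leNgt.
  rewrite ler_pdivrMr //; have [m Lm hm] := hy L.
  rewrite -[X in `‖X‖](subrK (\sum_i X m i * w 0 i)) -sumrB; apply: vabsD_le.
    apply: vabs_sum_le => [|i _ _]; first by rewrite mulr_ge0 ?ltW.
    by rewrite -mulrBl vabsM ler_pM ?vabs_ge0 //; apply: YX Lm hm i.
  apply: le_trans (XW m) _; apply: (@le_trans _ _ (q ^- L)).
    by rewrite lef_pV2 ?posrE ?exprn_gt0 ?q_gt0 // ler_eXn2l ?q_gt1.
  by rewrite ler_peMr // ltW.
have Y0 : forall i, Y i = 0.
  by apply: Pw YW0 => i; exists 0, (fun j => y j 0 i).
have [m m1 hm] := hy 1; have [_ [i ai] _] := haD m.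
have := YX 1 m m1 hm i; rewrite Y0 sub0r vabsN; apply/negP; rewrite -ltNge.
have [sD _ _] := haD m.
have sE : size ((aD m).1 0%R i) = (aD m).2.+1.
  apply/eqP; rewrite eqn_leq sD /= ltnNge; apply: contra ai => h.
  by rewrite nth_default.
have p0 : (aD m).1 0 i != 0 by rewrite -size_poly_gt0 sE.
rewrite /X vabsM vabsV vabsX vabs_embX vabs_emb // sE /= divff ?expf_neq0 ?q_neq0 //.
by rewrite expr1 invf_lt1 ?q_gt0 // q_gt1.
Qed.

Lemma bounded_polys B : exists J : seq A, forall p : A, (size p <= B)%N -> p \in J.
Proof.
exists [seq val x | x : {poly_B F}] => p sp; apply/mapP; exists (npolyp B p) => //.
  by rewrite mem_enum.
by rewrite /= npolypK.
Qed.

Lemma bounded_poly_rows r B : exists J : seq 'rV[A]_r,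
  forall a : 'rV[A]_r, (forall i, (size (a 0%R i) <= B)%N) -> a \in J.
Proof.
exists [seq map_mx val x | x : 'rV[{poly_B F}]_r] => a sa; apply/mapP.
exists (map_mx (npolyp B) a); first by rewrite mem_enum.
by apply/rowP => i; rewrite !mxE /= npolypK.
Qed.

Lemma exprVn_lt (x : C) (e : R) k : (0 < k)%N -> 1 < `‖x‖ -> e^-1 < `‖x‖ -> 0 < e ->
  `‖x ^- k‖ < e.
Proof.
move=> k0 x1 xe e0; have x0 : 0 < `‖x‖ := lt_trans ltr01 x1.
rewrite vabsV vabsX -[e]invrK ltf_pV2 ?posrE ?exprn_gt0 ?invr_gt0 //.
by apply: lt_le_trans xe _; rewrite ler_eXnr // ltW.
Qed.

Lemma poly_tail k (P : set A) : (0 < k)%N -> forall e : R, 0 < e ->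
  exists J, tail_lt P (fun h => embA h ^- k) e J.
Proof.
move=> k0 e e0; have e1 : 0 < Num.min 1 e by rewrite lt_min ltr01.
have [n] := q_small F e1; rewrite lt_min => /andP[n1 ne].
have [J hJ] := bounded_polys n.+1; exists J => h _ hnJ.
have nh : (n < size h)%N by rewrite ltnNge; apply: contra hnJ => sh; apply: hJ (leqW sh).
have qh : q ^+ n <= `‖embA h‖ by apply: vabs_emb_gt.
have qn0 : 0 < q ^+ n by rewrite exprn_gt0 // q_gt0.
apply: exprVn_lt => //; apply: lt_le_trans qh.
  by rewrite -invf_lt1.
by rewrite -[q ^+ n]invrK ltf_pV2 ?posrE ?invr_gt0.
Qed.

(** By discreteness, [|a w|] is large unless all the entries of [a] have small
    degree. *)
Lemma lattice_tail r (w : 'rV[C]_r) k (P : set 'rV[A]_r) : vcomplete C -> Psi w ->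
  (0 < k)%N -> forall e : R, 0 < e ->
  exists J, tail_lt P (fun a => pairing (toK a) w ^- k) e J.
Proof.
move=> hC Pw k0 e e0; have [c c0 hc] := Psi_discrete hC Pw.
pose d := Num.min 1 e; have d0 : 0 < d by rewrite lt_min ltr01.
have e1 : 0 < c * d by rewrite mulr_gt0.
have [n hn] := q_small F e1.
have [J hJ] := bounded_poly_rows r n; exists J => a _ anJ.
have [i ni] : exists i, (n < size (a 0%R i))%N.
  apply: contrapT => /forallNP h; move/negP: anJ; apply; apply: hJ => i.
  by rewrite leqNgt; apply/negP.
have qn0 : 0 < q ^+ n by rewrite exprn_gt0 // q_gt0.
have h : d^-1 < `‖pairing (toK a) w‖.
  apply: lt_le_trans (hc a i).
  have := vabs_emb_gt C ni; rewrite -(ler_pM2l c0) => /(lt_le_trans _); apply.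
  by rewrite -(ltr_pM2l d0) divff ?lt0r_neq0 // mulrA [d * c]mulrC -ltr_pdivrMr // div1r.
have h1 : d^-1 >= 1 by rewrite invf_ge1 // ge_min lexx.
have h2 : d^-1 >= e^-1 by rewrite lef_pV2 ?posrE // ge_min lexx orbT.
by apply: exprVn_lt => //; apply: le_lt_trans h.
Qed.

End LatticeSums.

(** * Points near the cusps *)

Section CuspPoint.
Variables (F : finFieldType) (R : realType) (C : valued_extension F R).
Local Notation "`‖ x ‖" := (vabs (x : C)) (at level 0, x at level 99, format "`‖ x ‖").
Local Notation A := {poly F}.
Local Notation embA p := (emb C (tofrac p)).
Local Notation q := (#|F|%:R : R).

Lemma Kinf_monomial (c : F) (m : int) : Kinf (embA c%:P * embA 'X ^ m).
Proof.
pose u (i : nat) : F := if i == 0%N then c else 0.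
exists m, u; apply/vcvgP => e e0; exists 1%N => // n /= n1.
rewrite /series /= big_ltn // big_nat big1 => [|i /andP[i1 _]].
  by rewrite addr0 /laurent_term subr0 subrr vabs0.
by rewrite /laurent_term /u gtn_eqF // polyC0 tofrac0 rmorph0 mul0r.
Qed.

Lemma Kinf_alg_monomial (c : F) (m : int) : Kinf_alg (embA c%:P * embA 'X ^ m).
Proof.
set x := _ * _; exists ('X - x%:P); split; rewrite ?polyXsubC_eq0 ?root_XsubC //.
move=> [|[|i]]; rewrite coefB coefX coefC /=.
- have := Kinf_monomial (- c) m.
  by rewrite polyCN tofracN rmorphN mulNr sub0r.
- by have := Kinf_monomial 1 0; rewrite expr0z mulr1 polyC1 tofrac1 rmorph1 subr0.
- by have := Kinf_monomial 0 0; rewrite polyC0 tofrac0 rmorph0 mul0r subr0.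
Qed.

(** Its powers below the [r]-th have absolute values in distinct classes modulo
    the value group of [F(T)], which supplies [r] elements independent over the
    completion of [F(T)]. *)
Lemma root_of_T r : is_Cinf C -> (0 < r)%N -> exists x : C, x ^+ r = embA 'X.
Proof.
move=> [_ hroot _] r0; have [||x _] := hroot ('X^r - (embA 'X)%:P).
- by rewrite size_XnsubC.
- move=> i; rewrite coefB coefXn coefC; case: eqVneq => [->|_].
    have := Kinf_alg_monomial 1 0.
    by rewrite expr0z mulr1 polyC1 tofrac1 rmorph1 gtn_eqF // subr0.
  case: eqVneq => _; last first.
    by have := Kinf_alg_monomial 0 0; rewrite polyC0 tofrac0 rmorph0 mul0r subr0.
  have := Kinf_alg_monomial (-1) 1.
  by rewrite polyCN polyC1 tofracN tofrac1 rmorphN rmorph1 mulN1r expr1z sub0r.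
rewrite /root !hornerE subr_eq0 => /eqP xr.
by exists x.
Qed.

(** The closure of [F(T)]. It contains the field of Laurent series, has the same
    absolute values, and is stable under the operations needed here for simpler
    reasons. *)
Definition Kclosure (x : C) : Prop :=
  forall e : R, 0 < e -> exists f, `‖x - emb C f‖ < e.

Lemma Kinf_closure x : Kinf x -> Kclosure x.
Proof.
move=> [m [c /vcvgP hx]] e /hx [n _ hn].
exists (\sum_(0 <= i < n) tofrac (c i)%:P * (tofrac 'X) ^ (m - i%:Z)).
rewrite vabs_subC rmorph_sum; have := hn n (leqnn n).
congr (`‖_ - _‖ < _); apply: eq_bigr => i _.
by rewrite rmorphM fmorphXz.
Qed.

Lemma Kclosure0 : Kclosure 0.
Proof. by move=> e e0; exists 0; rewrite rmorph0 subr0 vabs0. Qed.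

Lemma KclosureD x y : Kclosure x -> Kclosure y -> Kclosure (x + y).
Proof.
move=> hx hy e e0; have [f hf] := hx e e0; have [g hg] := hy e e0.
by exists (f + g); rewrite rmorphD opprD addrACA; apply: vabsD_lt.
Qed.

Lemma KclosureM x (p : A) : Kclosure x -> Kclosure (x * embA p).
Proof.
move=> hx; have [->|p0] := eqVneq p 0.
  by rewrite tofrac0 rmorph0 mulr0; apply: Kclosure0.
have p1 : 0 < `‖embA p‖ by rewrite vabs_gt0 embA_neq0.
move=> e e0; have [f hf] := hx _ (divr_gt0 e0 p1).
by exists (f * tofrac p); rewrite rmorphM -mulrBl vabsM -ltr_pdivlMr.
Qed.

Lemma Kclosure_sum (I : finType) (f : I -> C) :
  (forall i, Kclosure (f i)) -> Kclosure (\sum_i f i).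
Proof.
move=> h; elim/big_ind: _ => // [|x y]; [exact: Kclosure0 | exact: KclosureD].
Qed.

Lemma fraction_num_den (S : idomainType) (f : {fraction S}) :
  exists n d : S, d != 0 /\ f = tofrac n / tofrac d.
Proof.
elim/quotW: f => x; exists (frac x).1, (frac x).2; have d0 := denom_ratioP x.
split=> //; apply: (canRL (mulfK _)); first by rewrite tofrac_eq0.
rewrite /FracField.tofrac; unlock; rewrite -[LHS]FracField.pi_mul.
apply/eqmodP; rewrite /= FracField.equivfE /FracField.mulf.
by rewrite !numden_Ratio ?oner_neq0 ?mulf_neq0 ?oner_neq0 // !mulr1 mulrC.
Qed.

Lemma vabs_emb_int (f : {fraction A}) : f != 0 -> exists z : int, `‖emb C f‖ = q ^ z.
Proof.
have [n [d [d0 ->]]] := fraction_num_den f => f0.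
have n0 : n != 0 by apply: contraNneq f0 => ->; rewrite tofrac0 mul0r.
exists ((size n).-1%:Z - (size d).-1%:Z).
by rewrite rmorphM fmorphV vabsM vabsV !vabs_emb // expfzDr ?q_neq0 // -exprnN.
Qed.

Lemma Kclosure_vabs x : Kclosure x -> x != 0 -> exists z : int, `‖x‖ = q ^ z.
Proof.
rewrite -(@vabs_gt0 _ _ C) => hx x0; have [f hf] := hx _ x0.
have e := vabs_close hf; rewrite -e; apply: vabs_emb_int.
by apply: contraTneq x0 => f0; rewrite -e f0 rmorph0 vabs0 ltxx.
Qed.

(** The absolute values of the powers [x ^+ i] with [i < r] lie in distinct
    classes modulo the value group of [F(T)], so no two terms have the same
    absolute value. *)
Lemma Kclosure_root_indep r (x : C) (c : 'I_r -> C) : x ^+ r = embA 'X ->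
  (forall i, Kclosure (c i)) ->
  forall i, `‖c i‖ * `‖x‖ ^+ i <= `‖\sum_j c j * x ^+ j‖.
Proof.
move=> xr hc i0; have xrq : `‖x‖ ^+ r = q by rewrite -vabsX xr vabs_embX.
have hr : (0 < r)%N := leq_ltn_trans (leq0n i0) (ltn_ord i0).
have x0 : x != 0.
  rewrite -(@vabs_neq0 _ _ C); apply: contraTneq (q_neq0 F R) => h.
  by rewrite -xrq h expr0n gtn_eqF // eqxx.
rewrite -vabsX -vabsM; apply: (vabs_sum_distinct (f := fun i : 'I_r => c i * x ^+ i)).
move=> i j ci /= e.
have cj : c j * x ^+ j != 0 by rewrite -(@vabs_neq0 _ _ C) -e vabs_neq0.
move: ci cj; rewrite !mulf_eq0 !negb_or => /andP[ci _] /andP[cj _].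
have [z hz] := Kclosure_vabs (hc i) ci; have [z' hz'] := Kclosure_vabs (hc j) cj.
have xp m (y : int) : (q ^ y * `‖x‖ ^+ m) ^+ r = q ^ (y * r%:Z + m%:Z).
  rewrite exprMn [(q ^ y) ^+ r]exprnP exprz_exp -exprM mulnC exprM xrq.
  by rewrite [q ^+ m]exprnP -expfzDr // q_neq0.
have := congr1 (fun y => y ^+ r) e.
rewrite !vabsM !vabsX hz hz' !xp => /(ieexprIz (q_gt0 F R)); rewrite gt_eqF ?q_gt1 // => /(_ isT).
move=> /(congr1 (modz^~ r%:Z)); rewrite !modzMDl !modz_small ?ltz_nat ?ltn_ord //.
by case=> ?; apply: val_inj.
Qed.

Lemma sum_basis r (V : 'M[A]_r) (c y : 'I_r -> C) :
  \sum_i c i * \sum_l embA (V i l) * y l = \sum_l (\sum_i c i * embA (V i l)) * y l.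
Proof.
under eq_bigr do rewrite mulr_sumr.
rewrite exchange_big; apply: eq_bigr => l _; rewrite mulr_suml.
by apply: eq_bigr => i _; rewrite mulrA.
Qed.

(** Complete [a0] to an invertible matrix and change coordinates so that [a0]
    becomes the [j]-th unit vector. Take coordinates [y l] with [y j = 1], the
    others larger than [1], and all of them with absolute values in distinct
    classes modulo the value group of [F(T)]. Then the value of a vector is at
    least as large as each of its terms, and a primitive vector that is not a
    multiple of [a0] has a nonzero term other than the [j]-th one. *)
Lemma cusp_point r (a0 : 'rV[A]_r) : is_Cinf C -> primitive a0 ->
  exists w : 'rV[C]_r, [/\ Psi w, pairing (toK a0) w = 1
    & forall a : 'rV[A]_r, primitive a -> (forall c : F, c != 0 -> a <> c%:P *: a0) ->
      1 < `‖pairing (toK a) w‖].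
Proof.
move=> hC pa0; have hr := primitive_gt0 pa0.
have [j [U [V [UV a0E]]]] := primitive_completes pa0.
have [x xr] := root_of_T hC hr.
have xrq : `‖x‖ ^+ r = q by rewrite -vabsX xr vabs_embX.
have x0 : x != 0.
  rewrite -(@vabs_neq0 _ _ C); apply: contraTneq (q_neq0 F R) => h.
  by rewrite -xrq h expr0n gtn_eqF // eqxx.
have xgt0 : 0 < `‖x‖ by rewrite vabs_gt0.
(* The extra factor [T] outweighs the quotient of two powers of [x] with
   exponents below [r]. *)
pose tau (l : 'I_r) : A := if l == j then 1 else 'X.
pose y (l : 'I_r) : C := embA (tau l) * x ^+ l / x ^+ j.
have y0 l : 0 < `‖y l‖.
  rewrite vabs_gt0 !mulf_neq0 ?invr_eq0 ?expf_neq0 // embA_neq0 /tau.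
  by case: ifP => _; rewrite ?oner_eq0 ?polyX_eq0.
have yj : y j = 1.
  by rewrite /y /tau eqxx tofrac1 rmorph1 mul1r divff ?expf_neq0.
have y_gt1 l : l != j -> 1 < `‖y l‖.
  move=> /negPf lj; rewrite /y /tau lj !vabsM vabsV !vabsX vabs_embX -xrq.
  rewrite ltr_pdivlMr ?exprn_gt0 // mul1r -exprD ltr_eXn2l.
    by rewrite (leq_trans (ltn_ord j)) // leq_addr.
  rewrite ltNge; apply/negP => x1; have := q_gt1 F R.
  by rewrite -xrq ltNge exprn_ile1 // ltW.
have y_indep (d : 'I_r -> C) : (forall l, Kclosure (d l)) ->
    forall l, `‖d l‖ * `‖y l‖ <= `‖\sum_l d l * y l‖.
  move=> hd l; have := Kclosure_root_indep xr (fun l => KclosureM (tau l) (hd l)) l.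
  have xj : 0 < `‖x ^+ j‖^-1 by rewrite invr_gt0 vabs_gt0 expf_neq0.
  have -> : \sum_l d l * y l = (\sum_l d l * embA (tau l) * x ^+ l) / x ^+ j.
    by rewrite mulr_suml; apply: eq_bigr => i _; rewrite /y !mulrA.
  by rewrite -(ler_pM2r xj) /y -vabsX -!vabsV -!vabsM !mulrA.
pose w : 'rV[C]_r := \row_i \sum_l embA (V i l) * y l.
have wE (c : 'I_r -> C) : \sum_i c i * w 0 i = \sum_l (\sum_i c i * embA (V i l)) * y l.
  by under eq_bigr do rewrite mxE; apply: sum_basis.
have pairE (a : 'rV[A]_r) : pairing (toK a) w = \sum_l embA ((a *m V) 0 l) * y l.
  rewrite pairing_toK wE; apply: eq_bigr => l _; congr (_ * _).
  by rewrite mxE !rmorph_sum; apply: eq_bigr => i _; rewrite !rmorphM.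
have a0V : a0 *m V = delta_mx 0 j by rewrite a0E -row_mul UV row1.
exists w; split.
- move=> c cK; rewrite wE => h.
  pose d l := \sum_i c i * embA (V i l).
  have dK l : Kclosure (d l).
    by apply: Kclosure_sum => i; apply/KclosureM/Kinf_closure.
  have d0 l : d l = 0.
    apply/vabs_eq0/eqP; rewrite eq_le vabs_ge0 andbT.
    have := y_indep d dK l; rewrite h vabs0.
    by rewrite pmulr_lle0.
  move=> i; have : \sum_l d l * embA (U l i) = c i.
    under eq_bigr do rewrite mulr_suml.
    rewrite exchange_big /= (bigD1 i) //= [X in _ + X]big1 ?addr0 => [|k ki].
      under eq_bigr do rewrite -mulrA -rmorphM -tofracM.
      rewrite -mulr_sumr -!rmorph_sum; have /matrixP/(_ i i) := mulmx1C UV.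
      by rewrite !mxE eqxx => ->; rewrite mulr1n !rmorph1 mulr1.
    under eq_bigr do rewrite -mulrA -rmorphM -tofracM.
    rewrite -mulr_sumr -!rmorph_sum; have /matrixP/(_ k i) := mulmx1C UV.
    by rewrite !mxE (negPf ki) => ->; rewrite mulr0n !rmorph0 mulr0.
  by move=> <-; rewrite big1 // => l _; rewrite d0 mul0r.
- rewrite pairE a0V (bigD1 j) //= mxE !eqxx yj tofrac1 rmorph1 mulr1.
  rewrite big1 ?addr0 // => l lj.
  by rewrite mxE eqxx (negPf lj) tofrac0 rmorph0 mul0r.
move=> a pa hne; have [l /andP[lj al]] : exists l, (l != j) && ((a *m V) 0 l != 0).
  apply/existsP; apply: contraT; rewrite negb_exists => /forallP none.
  have aV : a = (a *m V) 0 j *: a0.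
    have VU := mulmx1C UV; rewrite -[LHS](mulmx1 a) -VU mulmxA.
    rewrite a0E rowE scalemxAl; congr (_ *m _); apply/rowP => l; rewrite !mxE.
    rewrite eqxx /=; case: (eqVneq l j) => [->|lj]; first by rewrite mulr1.
    by have := none l; rewrite lj /= negbK mxE => /eqP ->; rewrite mulr0.
  have /primitiveP[b ba] := pa.
  have [|c c0 gc] := @poly_mul_eq1 _ ((a *m V) 0 j) (\sum_i b 0 i * a0 0 i).
    rewrite mulr_sumr -ba; apply: eq_bigr => i _.
    have -> : a 0 i = (a *m V) 0 j * a0 0 i by rewrite {1}aV [LHS]mxE.
    by rewrite mulrCA.
  by exfalso; apply: (hne c c0); rewrite -gc.
have aK m : Kclosure (embA ((a *m V) 0 m)).
  by move=> e e0; exists (tofrac ((a *m V) 0 m)); rewrite subrr vabs0.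
rewrite pairE; apply: lt_le_trans (y_indep _ aK l).
rewrite (lt_le_trans (y_gt1 _ lj)) // ler_peMl ?vabs_ge0 //.
exact: vabs_emb_ge1.
Qed.

End CuspPoint.

(** * Linear spans and bases *)

Section LinearSpans.
Variables (R : nzRingType) (V : lmodType R).

Lemma lin_span_gen (I : finType) (b : I -> V) i : lin_span b (b i).
Proof.
exists (fun j => (j == i)%:R); rewrite (bigD1 i) //= eqxx scale1r big1 ?addr0 //.
by move=> j /negPf ->; rewrite scale0r.
Qed.

Lemma lin_span_sum (I J : finType) (b : I -> V) (g : J -> V) (x : J -> R) :
  (forall j, lin_span b (g j)) -> lin_span b (\sum_j x j *: g j).
Proof.
move=> /choice [c hc]; exists (fun i => \sum_j x j * c j i).
under eq_bigr do rewrite hc scaler_sumr.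
rewrite exchange_big; apply: eq_bigr => i _; rewrite scaler_suml.
by apply: eq_bigr => j _; rewrite scalerA.
Qed.

Lemma lin_spanZ (I : finType) (b : I -> V) c v : lin_span b v -> lin_span b (c *: v).
Proof.
move=> [x ->]; exists (fun i => c * x i); rewrite scaler_sumr.
by apply: eq_bigr => i _; rewrite scalerA.
Qed.

Lemma is_basis_reindex (I J : finType) (g : J -> I) (b : I -> V) (W : set V) :
  bijective g -> is_basis b W -> is_basis (b \o g) W.
Proof.
move=> bg [bfree bspan]; have [g' gK g'K] := bg; split.
  move=> c hc j; rewrite -(gK j); apply: (bfree (c \o g')).
  rewrite -[RHS]hc (reindex g); last exact: onW_bij.
  by apply: eq_bigr => i _; rewrite /= gK.
rewrite -bspan; apply/seteqP; split=> _ [c ->].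
  by apply: lin_span_sum => j; apply: lin_span_gen.
by apply: lin_span_sum => i; rewrite -(g'K i); apply: (lin_span_gen (b \o g)).
Qed.

End LinearSpans.

Section Combination.
Variables (F : finFieldType) (R : realType) (C : valued_extension F R).
Local Notation "`‖ x ‖" := (vabs (x : C)) (at level 0, x at level 99, format "`‖ x ‖").

(** The matrix [B] has a trivial kernel, hence is invertible. *)
Lemma near_identity_solve (I : finType) (V : lmodType C) (B : I -> I -> C) (e f : I -> V) :
  (forall i j, `‖B i j - (i == j)%:R‖ < 1) -> (forall i, e i = \sum_j B i j *: f j) ->
  forall j, lin_span e (f j).
Proof.
move=> hB he j.
pose M := \matrix_(k < #|I|, l < #|I|) B (enum_val k) (enum_val l).
have rk (g : 'I_#|I| -> C) : \sum_k g k = \sum_i g (enum_rank i).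
  by rewrite (reindex (@enum_rank I)) //; apply/onW_bij/enum_rank_bij.
have Mu : M \in unitmx.
  rewrite unitmxE unitfE; apply/det0P => -[v v0 vM]; case/eqP: v0.
  have h := near_identity_inj hB (c := fun i => v 0 (enum_rank i)).
  apply/rowP => k; rewrite mxE -(enum_valK k); apply: h => l.
  have /eqP := congr1 (fun u : 'rV_#|I| => u 0 (enum_rank l)) vM.
  rewrite !mxE => /eqP vMl; rewrite -[RHS]vMl (rk (fun k => v 0 k * M k (enum_rank l))).
  by apply: eq_bigr => i _; rewrite mxE !enum_rankK.
exists (fun i => invmx M (enum_rank j) (enum_rank i)).
have inv l : \sum_i invmx M (enum_rank j) (enum_rank i) * B i l = (j == l)%:R.
  have <- : (invmx M *m M) (enum_rank j) (enum_rank l) = (j == l)%:R.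
    by rewrite mulVmx // mxE (inj_eq enum_rank_inj).
  rewrite mxE (rk (fun k => invmx M (enum_rank j) k * M k (enum_rank l))).
  by apply: eq_bigr => i _; rewrite [M _ _]mxE !enum_rankK.
under eq_bigr do rewrite he scaler_sumr.
rewrite exchange_big (bigD1 j) //= [X in _ + X]big1 => [|l lj].
  by under eq_bigr do rewrite scalerA; rewrite -scaler_suml inv eqxx scale1r addr0.
by under eq_bigr do rewrite scalerA; rewrite -scaler_suml inv eq_sym (negPf lj) scale0r.
Qed.

Lemma has_vsumZ (I : choiceType) (P : set I) (f : I -> C) s (c : C) :
  has_vsum P f s -> has_vsum P (fun i => c * f i) (c * s).
Proof.
move=> /has_vsumP hs; apply/has_vsumP => e e0.
have B0 : 0 < `‖c‖ + 1 by rewrite ltr_wpDl ?vabs_ge0.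
have [J [uJ JP tJ sJ]] := hs _ (divr_gt0 e0 B0); exists J.
have lt_e x : `‖x‖ < e / (`‖c‖ + 1) -> `‖c * x‖ < e.
  rewrite ltr_pdivlMr // => hx; rewrite vabsM mulrC; apply: le_lt_trans hx.
  by rewrite ler_wpM2l ?vabs_ge0 // lerDl.
split=> //; first by move=> i Pi /(tJ i Pi); apply: lt_e.
by rewrite -mulr_sumr -mulrBr; apply: lt_e.
Qed.

End Combination.

(** * Restricted Eisenstein series *)

Section Eisenstein.
Variables (F : finFieldType) (R : realType) (C : valued_extension F R).
Hypothesis hC : is_Cinf C.
Variables (r : nat) (N : {poly F}) (k : nat).
Hypotheses (hr : (2 <= r)%N) (hN : N \is monic) (hd : (1 < size N)%N) (hk : (1 <= k)%N).
Local Notation "`‖ x ‖" := (vabs (x : C)) (at level 0, x at level 99, format "`‖ x ‖").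
Local Notation A := {poly F}.
Local Notation Q := {poly %/ N}.
Local Notation embA p := (emb C (tofrac p)).
Local Notation q := (#|F|%:R : R).
Local Notation red := (map_mx (in_qpoly N) : 'rV[A]_r -> 'rV[Q]_r).
Local Notation S := {n : 'rV[Q]_r | n \in monic_prim r N}.
Local Notation Fam n := (Fr C N k (divN n)).

Lemma N_neq0 : tofrac N != 0.
Proof. by rewrite tofrac_eq0 monic_neq0. Qed.

Lemma toK_inj : injective (@toK F r).
Proof.
move=> a b /rowP e; apply/rowP => i; have := e i; rewrite !mxE => /eqP.
by rewrite tofrac_eq => /eqP.
Qed.

Lemma toKZ (h : A) (a : 'rV[A]_r) : toK (h *: a) = tofrac h *: toK a.
Proof. by apply/rowP => i; rewrite !mxE tofracM. Qed.

Lemma toKD (a b : 'rV[A]_r) : toK (a + b) = toK a + toK b.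
Proof. by apply/rowP => i; rewrite !mxE tofracD. Qed.

Lemma divN_lift (n : 'rV[Q]_r) : tofrac N *: divN n = toK (lift_rV n).
Proof. by apply/rowP => i; rewrite !mxE mulrC divfK ?N_neq0. Qed.

Lemma red_class (a : 'rV[A]_r) (n : 'rV[Q]_r) :
  red a = n <-> exists b, toK a - tofrac N *: divN n = tofrac N *: toK b.
Proof.
rewrite divN_lift; have e b : toK a - toK (lift_rV n) = tofrac N *: toK b <->
    a = lift_rV n + N *: b.
  rewrite -toKZ; split=> [/eqP|->]; last by rewrite toKD addrC addKr.
  by rewrite subr_eq -toKD => /eqP /toK_inj ->; rewrite addrC.
rewrite -{1}(red_lift n); split=> [/(red_eq hN hd)[b /e]|[b /e h]].
  by exists b.
by apply/(red_eq hN hd); exists b.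
Qed.

Definition prim_class (n : 'rV[Q]_r) : set 'rV[A]_r :=
  [set a | primitive a /\ red a = n].

Lemma FrE n (w : {w : 'rV[C]_r | Psi w}) s :
  has_vsum (prim_class n) (fun a => pairing (toK a) (sval w) ^- k) s ->
  Fam n w = embA N ^- k * s.
Proof.
move=> hs; rewrite /Fr; congr (_ * _).
rewrite (_ : [set a | _] = prim_class n); first exact: vsumE.
by apply/seteqP; split=> a /= [pa /red_class h].
Qed.

Lemma prim_class_summable n (w : {w : 'rV[C]_r | Psi w}) :
  exists s, has_vsum (prim_class n) (fun a => pairing (toK a) (sval w) ^- k) s.
Proof.
have [hcomp _ _] := hC; apply: has_vsum_exists => // e e0.
exact: lattice_tail (svalP w) hk e e0.
Qed.

Definition mult_class (n n' : 'rV[Q]_r) : set A :=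
  [set h | h != 0 /\ in_qpoly N h *: n' = n].

(** The coefficients of the Eisenstein series on the restricted ones, up to a
    power of [N]. *)
Definition mult_coef (n n' : 'rV[Q]_r) : C :=
  vsum (mult_class n n') (fun h => embA h ^- k).

Lemma mult_coefP n n' :
  has_vsum (mult_class n n') (fun h => embA h ^- k) (mult_coef n n').
Proof.
have [hcomp _ _] := hC.
have [s hs] := has_vsum_exists hcomp (poly_tail C (mult_class n n') hk).
by rewrite /mult_coef (vsumE hs).
Qed.

Lemma vabs_exprVn_lt1 (x : C) : 1 < `‖x‖ -> `‖x ^- k‖ < 1.
Proof. by move=> x1; apply: exprVn_lt => //; rewrite invr1. Qed.

(** The only [h] of absolute value [1] that can occur is [h = 1], and it occurs
    exactly when [n = n']. *)
Lemma mult_coef_near (n n' : S) :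
  `‖mult_coef (val n) (val n') - (n == n')%:R‖ < 1.
Proof.
have small h : mult_class (val n) (val n') h -> ~~ ((h == 1) && (n == n')) ->
    `‖embA h ^- k‖ < 1.
  move=> [h0 hn] hne; apply: vabs_exprVn_lt1.
  have : (1 < size h)%N.
    rewrite ltnNge; apply: contra hne => sh.
    have [-> nn'] := monic_prim_scaled hN hd h0 (valP n) (valP n') hn sh.
    by rewrite eqxx; apply/eqP/val_inj.
  by move/(vabs_emb_gt C); apply: lt_le_trans; rewrite expr1 q_gt1.
have hs := mult_coefP (val n) (val n').
have [nn'|nn'] := eqVneq n n'; last first.
  rewrite subr0; apply: has_vsum_lt hs _ => // h /small; apply.
  by rewrite (negPf nn') andbF.
have f1 : embA 1 ^- k = 1 by rewrite tofrac1 rmorph1 expr1n invr1.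
rewrite mulr1n -f1; apply: (has_vsum_dom _ hs) => //.
- by split; [exact: oner_neq0 | rewrite nn' rmorph1 scale1r].
- by rewrite f1 vabs1.
- by move=> h /small hs1 h1; apply: hs1; rewrite (negPf h1).
Qed.

(** The summation index of the Eisenstein series is [h a' / N], where [h] is
    nonzero and [a'] is primitive with monic reduction [n']. For fixed [n'] the
    sum over [h] and [a'] is the product of two sums, because the value of
    [h a' / N] at [w] is the product of [h / N] and the value of [a'], and
    because the condition [h n' = n] does not involve [a']. *)
Lemma E_decomp (n : 'rV[Q]_r) : E C k (divN n) =
  \sum_(n' : S) (embA N ^+ k * mult_coef n (val n') * embA N ^+ k) *: Fam (val n').
Proof.
apply/funext => w; rewrite fct_sumE.
have N0 : embA N != 0 by rewrite embA_neq0 monic_neq0.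
have /choice [G hG] := fun n' : S => prim_class_summable (val n') w.
have hsum := has_vsum_sig (fun n' : S =>
  has_vsumZ (embA N ^+ k) (has_vsumM (mult_coefP n (val n')) (hG n'))).
rewrite (_ : \sum_n' _ = \sum_n' embA N ^+ k * (mult_coef n (val n') * G n')); last first.
  apply: eq_bigr => n' _; rewrite -[LHS]/(_ * Fam (val n') w) (FrE (hG n')).
  by rewrite -!mulrA mulVKf // expf_neq0.
apply: vsumE.
apply: (has_vsum_reindex (phi := fun ti : S * (A * 'rV[A]_r) =>
  (tofrac N)^-1 *: toK (ti.2.1 *: ti.2.2)) hsum) => /=.
- move=> [n1 [h1 a1]] [n2 [h2 a2]] /= [[h10 _] [p1 r1]] [[h20 _] [p2 r2]].
  move=> /(scalerI (invr_neq0 N_neq0)) /toK_inj e.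
  have m1 : red a1 \in monic_prim r N by rewrite r1; apply: valP.
  have m2 : red a2 \in monic_prim r N by rewrite r2; apply: valP.
  have [-> aE] := monic_factor_uniq hN hd h10 h20 p1 p2 m1 m2 e.
  by rewrite aE; congr (_, _); apply: val_inj; rewrite /= -r1 -r2 aE.
- move=> l; split=> [[l0 [b lb]]|[[n' [h a]] /= [[h0 hn] [pa ra]] <-]].
    pose v := lift_rV n + N *: b.
    have lE : l = (tofrac N)^-1 *: toK v.
      rewrite toKD toKZ -divN_lift -scalerDr scalerA mulVf ?N_neq0 // scale1r.
      by rewrite -lb addrC subrK.
    have v0 : v != 0.
      apply: contraNneq l0 => v0; rewrite lE v0.
      by apply/eqP/rowP => i; rewrite !mxE tofrac0 mulr0.
    have [h [a [h0 pa aS vE]]] := monic_factor hN hd v0.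
    exists (exist _ (red a) aS, (h, a)) => /=; last by rewrite -vE.
    by do !split=> //; rewrite -redZ -vE; apply/red_class; rewrite lE in lb *; exists b;
      rewrite toKD divN_lift addrC addKr toKZ.
  split.
    rewrite scaler_eq0 invr_eq0 (negPf N_neq0) /=.
    apply: contra_neq (prim_neq0 (red_prim N pa)) => /eqP.
    rewrite toKZ scaler_eq0 tofrac_eq0 (negPf h0) /=.
    move=> /eqP a0; apply/rowP => i; have /rowP/(_ i) := a0; rewrite !mxE => /eqP.
    by rewrite tofrac_eq0 => /eqP ->; rewrite in_qpoly0.
  have /red_class [b hb] : red (h *: a) = n by rewrite redZ ra.
  exists b; apply: (scalerI N_neq0); rewrite -hb scalerBr scalerA divff ?N_neq0 //.
  by rewrite scale1r.
- move=> [n' [h a]] /= _; rewrite -exprVn -!exprVn -!exprMn; congr (_ ^+ _).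
  rewrite -invfM -[in RHS](invrK (embA N)) -invfM; congr (_^-1).
  rewrite /pairing mulr_sumr mulr_sumr; apply: eq_bigr => i _.
  by rewrite !mxE tofracM !rmorphM fmorphV !mulrA.
Qed.

(** Evaluate a relation near the cusp of each [m]: at that point a primitive
    vector contributes a term of absolute value [1] only if it is a constant
    multiple of the lift of [m], and its reduction is monic only if that
    constant is [1]. *)
Lemma Fam_free : lin_indep (fun n : S => Fam (val n)).
Proof.
move=> c hc.
have N0 : embA N != 0 by rewrite embA_neq0 monic_neq0.
have /choice [w hw] : forall m : S, exists w : {w : 'rV[C]_r | Psi w}, forall n : S,
    `‖embA N ^+ k * Fam (val n) w - (n == m)%:R‖ < 1.
  move=> m; have /(monic_primP (val m))[mprim mmon] := valP m.
  have [a0 pa0 ra0] := prim_lift hN hd hr mprim.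
  have [w [Pw w1 hw]] := cusp_point hC pa0; exists (exist _ w Pw) => n.
  have [s hs] := prim_class_summable (val n) (exist _ w Pw).
  rewrite (FrE hs) mulVKf ?expf_neq0 //.
  have /(monic_primP (val n))[_ nmon] := valP n.
  have small a : prim_class (val n) a -> ~~ ((a == a0) && (n == m)) ->
      `‖pairing (toK a) w ^- k‖ < 1.
    move=> [pa ra] hne; apply/vabs_exprVn_lt1/hw => // c' c'0 aE; case/negP: hne.
    have nE : val n = qpolyC N c' *: val m by rewrite -ra -ra0 aE redZ in_qpolyC.
    have c1 : c' = 1 by apply: (monic_elt_scale hN hd c'0 mmon); rewrite -nE.
    rewrite aE c1 scale1r eqxx; apply/eqP/val_inj.
    by rewrite nE c1 rmorph1 scale1r.
  have [nm|nm] := eqVneq n m; last first.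
    rewrite subr0; apply: has_vsum_lt hs _ => // a /small; apply.
    by rewrite (negPf nm) andbF.
  have f1 : pairing (toK a0) w ^- k = 1 by rewrite w1 expr1n invr1.
  rewrite mulr1n -f1; apply: (has_vsum_dom (i0 := a0) _ hs) => //.
  - by split=> //; rewrite nm.
  - by rewrite f1 vabs1.
  - by move=> a /small hs1 h1; apply: hs1; rewrite (negPf h1).
apply: (near_identity_inj (B := fun n m => embA N ^+ k * Fam (val n) (w m))) => //.
move=> m; under eq_bigr do rewrite mulrCA.
rewrite -mulr_sumr; have /(congr1 (@^~ (w m))) := hc; rewrite fct_sumE => h.
by rewrite [X in _ * X]h mulr0.
Qed.

Lemma Fam_basis : is_basis (fun n : S => Fam (val n)) (Eis C r N k).
Proof.
split; first exact: Fam_free.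
have N0 : embA N != 0 by rewrite embA_neq0 monic_neq0.
apply/seteqP; split=> _ [c ->]; apply: lin_span_sum => n; last first.
  rewrite E_decomp; apply: lin_span_sum => n'.
  exact: (lin_span_gen (fun n : S => Fam (val n))).
set x := embA N ^+ k * embA N ^+ k; have x0 : x != 0 by rewrite mulf_neq0 // expf_neq0.
have solve := near_identity_solve (e := fun n : S => E C k (divN (val n)))
  (f := fun n : S => x *: Fam (val n)) mult_coef_near.
rewrite -[Fam _]scale1r -(mulVf x0) -scalerA; apply: lin_spanZ.
have [m|d ->] := solve _ n.
  by rewrite E_decomp; apply: eq_bigr => n' _; rewrite [RHS]scalerA; congr (_ *: _); rewrite mulrAC [RHS]mulrC.
by apply: lin_span_sum => m; apply: (lin_span_gen (fun n => E C k (divN n))).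
Qed.

Lemma Eis_dim : has_dim (Eis C r N k) #|monic_prim r N|.
Proof.
pose g (i : 'I_#|monic_prim r N|) : S := exist _ (enum_val i) (enum_valP i).
exists ((fun n : S => Fam (val n)) \o g); apply: is_basis_reindex Fam_basis.
apply: inj_card_bij; first by move=> i j /(congr1 val)/enum_val_inj.
by rewrite card_ord card_sig; apply/eq_leq/eq_card.
Qed.

End Eisenstein.

Theorem corollary4p7 (F : finFieldType) (R : realType)
    (C : valued_extension F R) (hC : is_Cinf C)
    (r : nat) (hr : (2 <= r)%N)
    (N : {poly F}) (hN : N \is monic) (hd : (1 < size N)%N)
    (k : nat) (hk : (1 <= k)%N) :
  [/\ lin_indep (fun n : {n | n \in monic_prim r N} =>
        Fr C N k (divN (val n))),
      is_basis (fun n : {n | n \in monic_prim r N} =>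
        Fr C N k (divN (val n))) (Eis C r N k),
      has_dim (Eis C r N k) #|monic_prim r N|
    & #|monic_prim r N| = #|cusps r N|].
Proof.
split; [exact: Fam_free | exact: Fam_basis | exact: Eis_dim | exact: card_monic_prim].
Qed.
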